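(* Let $k\geq 2$ and let $F$ be a strictly $k$-balanced $k$-graph on $m$ vertices with $k$-density $\rho$. Then there exists $\varepsilon_0\in(0,1)$ such that for all $0<\varepsilon<\varepsilon_0$ there exists $n_0$ such that for all $n\geq n_0$ and all $(4m,n^{\varepsilon^4})$-bounded and $F$-populated $k$-graphs $H$ on $n$ vertices with $n^{k-1/\rho-\varepsilon^4}\leq e(H)\leq n^{k-1/\rho+\varepsilon^4}$, with probability at least $1-\exp(-n^{1/4})$, we have $$R(H,F)\geq n^{k-1/\rho-\varepsilon}.$$
   Context: A $k$-graph is a (finite) $k$-uniform hypergraph; $V(G),E(G)$ denote vertex and edge set, $v(G)=|V(G)|$, $e(G)=|E(G)|$, and $G[I]$ is the subgraph induced by $I\subseteq V(G)$. If $v(G)\geq k+1$, the $k$-density of $G$ is $\rho_G:=(e(G)-1)/(v(G)-k)$. A $k$-graph $F$ is strictly $k$-balanced if it has at least three edges and $\rho_G<\rho_F$ for all proper subgraphs $G$ of $F$ that have at least two edges. Removal process: given a $k$-graph $H$, the $F$-removal process starting at $H$ iteratively removes all edges of a copy of $F$ (subgraph isomorphic to $F$) chosen uniformly at random among all remaining copies of $F$, until no copies are left. $R(H,F)$ is the (random) final number of edges. Templates: a $k$-template is a pair $(A,I)$ of a $k$-graph $A$ and a set $I\subseteq V(A)$. Its density is $\rho_{A,I}:=\frac{e(A)-e(A[I])}{v(A)-|I|}$ if $V(A)\neq I$ and $\rho_{A,I}:=0$ otherwise. $(B,J)\subseteq(A,I)$ means $B\subseteq A$ (subgraph) and $J=I$.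 $(A,I)$ is strictly balanced if $\rho_{B,I}<\rho_{A,I}$ for all $(B,I)\subseteq(A,I)$ with $V(B)\neq I$ and $B\neq A$. For $s,c\geq 0$, a $k$-graph $H$ on $n$ vertices with $\theta n^k/k!$ edges is $(s,c)$-bounded if for all strictly balanced $k$-templates $(A,I)$ with $v(A)\leq s$ and all injections $\psi\colon I\to V(H)$, the number of injections $\varphi\colon V(A)\to V(H)$ with $\varphi|_I=\psi$ and $\varphi(e)\in E(H)$ for all $e\in E(A)$ with $e\not\subseteq I$ is at most $c\cdot\max\{1,\hat\varphi\}$, where $\hat\varphi:=n^{v(A)-|I|}\theta^{e(A)-e(A[I])}$. $H$ is $F$-populated if every edge of $H$ is an edge of at least two copies of $F$ in $H$. *)

(* Defs.v *)
From HB Require Import structures.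
From mathcomp Require Import all_boot all_order all_algebra.
From mathcomp Require Import reals.

Set Implicit Arguments.
Unset Strict Implicit.
Unset Printing Implicit Defensive.
Import Order.TTheory GRing.Theory Num.Theory.
Local Open Scope ring_scope.

(* A k-graph carries its own vertex set inside an ambient finite type, so that
   subgraphs with fewer vertices are again k-graphs over the same type. *)
Definition is_kgraph (k : nat) (T : finType)
    (G : {set T} * {set {set T}}) : bool :=
  [forall e in G.2, (e \subset G.1) && (#|e| == k)].

Record kgraph (k : nat) (T : finType) := KGraph {
  kgraph_val : {set T} * {set {set T}};
  kgraph_valP : is_kgraph k kgraph_val }.

HB.instance Definition _ k T := [isSub for @kgraph_val k T].
HB.instance Definition _ k T := [Finite of kgraph k T by <:].

Definition vset k T (G : kgraph k T) : {set T} := (kgraph_val G).1.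
Definition eset k T (G : kgraph k T) : {set {set T}} := (kgraph_val G).2.
Definition nv k T (G : kgraph k T) : nat := #|vset G|.
Definition ne k T (G : kgraph k T) : nat := #|eset G|.

Definition subgraph k T (G H : kgraph k T) : bool :=
  (vset G \subset vset H) && (eset G \subset eset H).

(* Only meaningful when k < nv G, which holds as soon as G has two edges. *)
Definition kdensity k T (G : kgraph k T) : rat :=
  ((ne G)%:R - 1) / ((nv G)%:R - k%:R).

Definition strictly_kbalanced k T (F : kgraph k T) : Prop :=
  (3 <= ne F)%N /\
  forall G : kgraph k T, subgraph G F -> G != F -> (2 <= ne G)%N ->
    kdensity G < kdensity F.

(* For f defined on a set A only, the image under f of e :&: A. *)
Definition img (T U : finType) (A : {set T}) (f : {x | x \in A} -> U)
    (e : {set T}) : {set U} :=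
  [set f x | x : {x | x \in A} & val x \in e].

Definition isomorphic k (T U : finType) (F : kgraph k T) (G : kgraph k U)
    : bool :=
  [exists f : {ffun {x | x \in vset F} -> U},
    [&& injectiveb f, img f (vset F) == vset G
      & [set img f e | e in eset F] == eset G]].

Definition copies k (T U : finType) (F : kgraph k T) (H : kgraph k U)
    : {set kgraph k U} :=
  [set G | subgraph G H && isomorphic F G].

Definition populated k (T U : finType) (F : kgraph k T) (H : kgraph k U)
    : Prop :=
  forall e, e \in eset H -> (2 <= #|[set G in copies F H | e \in eset G]|)%N.

(* The number of edges of A[I]. *)
Definition ne_in k T (A : kgraph k T) (I : {set T}) : nat :=
  #|[set e in eset A | e \subset I]|.

Definition tdensity k T (A : kgraph k T) (I : {set T}) : rat :=
  if vset A == I then 0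
  else ((ne A)%:R - (ne_in A I)%:R) / ((nv A)%:R - #|I|%:R).

Definition template k T (A : kgraph k T) (I : {set T}) : bool :=
  I \subset vset A.

Definition strictly_balanced k T (A : kgraph k T) (I : {set T}) : Prop :=
  forall B : kgraph k T, template B I -> subgraph B A ->
    vset B != I -> B != A -> tdensity B I < tdensity A I.

Definition extensions k (T U : finType) (A : kgraph k T) (I : {set T})
    (H : kgraph k U) (psi : {x | x \in I} -> U)
    : {set {ffun {x | x \in vset A} -> U}} :=
  [set phi : {ffun {x | x \in vset A} -> U} |
    [&& injectiveb phi,
        [forall x, phi x \in vset H],
        [forall x, forall y, (val x == val y) ==> (phi x == psi y)]
      & [forall e in eset A, ~~ (e \subset I) ==> (img phi e \in eset H)]]].

(* theta is defined by ne H = theta * n ^ k / k!. *)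
Definition theta (R : realType) k U (H : kgraph k U) : R :=
  (ne H)%:R * (k`!)%:R / (nv H)%:R ^+ k.

Definition phihat (R : realType) k (T U : finType) (A : kgraph k T)
    (I : {set T}) (H : kgraph k U) : R :=
  (nv H)%:R ^+ (nv A - #|I|) * theta R H ^+ (ne A - ne_in A I).

Definition bounded (R : realType) k (U : finType) (s : nat) (c : R)
    (H : kgraph k U) : Prop :=
  forall (T : finType) (A : kgraph k T) (I : {set T}),
    template A I -> strictly_balanced A I -> (nv A <= s)%N ->
    forall psi : {x | x \in I} -> U,
      injective psi -> (forall x, psi x \in vset H) ->
      #|extensions A H psi|%:R <= c * Num.max 1 (phihat R A I H).

Lemma remove_edges_subproof k T (G C : kgraph k T) :
  is_kgraph k (vset G, eset G :\: eset C).
Proof.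
apply/forall_inP => e /=; rewrite inE => /andP[_ eG].
exact: (forall_inP (kgraph_valP G)).
Qed.

Definition remove_edges k T (G C : kgraph k T) : kgraph k T :=
  KGraph (remove_edges_subproof G C).

(* Probability that the F-removal process starting at G stops within N steps
   with a final number of edges satisfying Q, by conditioning on the first
   removed copy, which is uniform among the remaining copies. *)
Fixpoint removal_prob_rec (R : realType) k (T U : finType) (F : kgraph k T)
    (Q : pred nat) (N : nat) (G : kgraph k U) : R :=
  if copies F G == set0 then (Q (ne G))%:R
  else if N is N'.+1 then
    (\sum_(C in copies F G) removal_prob_rec R F Q N' (remove_edges G C))
      / #|copies F G|%:R
  else 0.

(* The probability that R(H, F) satisfies Q.  If F has an edge, each step
   removes an edge, so ne H steps suffice: see removal_prob_total. *)
Definition removal_prob (R : realType) k (T U : finType) (F : kgraph k T)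
    (H : kgraph k U) (Q : pred nat) : R :=
  removal_prob_rec R F Q (ne H) H.

Lemma ne_remove_copy k (T U : finType) (F : kgraph k T) (G C : kgraph k U) :
  (0 < ne F)%N -> C \in copies F G -> (ne (remove_edges G C) < ne G)%N.
Proof.
move=> F0; rewrite inE => /andP[/andP[_ sCG] /existsP[f /and3P[_ _ /eqP EC]]].
have [e eF] : exists e, e \in eset F by apply/set0Pn; rewrite -card_gt0.
have eC : img f e \in eset C by rewrite -EC imset_f.
apply: proper_card; apply/properP; split; first exact: subsetDl.
by exists (img f e); [exact: (subsetP sCG) | rewrite inE eC].
Qed.

Lemma removal_prob_total (R : realType) k (T U : finType) (F : kgraph k T)
    (H : kgraph k U) : (0 < ne F)%N -> removal_prob R F H predT = 1.
Proof.
move=> F0; rewrite /removal_prob.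
suff rec N (G : kgraph k U) : (ne G <= N)%N ->
    removal_prob_rec R F predT N G = 1 by exact: rec.
elim: N G => [|N IHN] G /= leGN; case: ifP => // /negbT /set0Pn[C CG].
  by have := leq_trans (ne_remove_copy F0 CG) leGN.
rewrite (eq_bigr (fun=> 1)) => [|D DG]; last first.
  by rewrite IHN // -ltnS (leq_trans (ne_remove_copy F0 DG)).
rewrite sumr_const divff // pnatr_eq0 -lt0n card_gt0.
by apply/set0Pn; exists C.
Qed.

(* Main.v *)
Require Import Defs.
From mathcomp Require Import all_boot all_order all_algebra.
From mathcomp Require Import boolp reals sequences exp.
From mathcomp Require Import zify ring lra.

(** View the copies of F in H as the hyperedges of an f-uniform hypergraph on
    the edge set of H, where f is the number of edges of F.  The removal process
    is then the random greedy matching of this hypergraph, and R(H, F) counts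
    the vertices that the matching leaves uncovered.  Let N be the number of
    edges of H.  Boundedness puts every edge of H in at most Dl = n^(eps^3)
    copies, and F-populated puts it in at least two.

    Many edges survive.  Consider a state with E edges and D copies left.  An
    edge in no copy is dead: it survives for ever.  A copy is lone if it shares
    no edge with another copy.
    - While the average degree f D / E exceeds 1 + eta, convexity of the square
      makes a random step destroy a larger proportion of the copies than of the
      edges.  So D^(qM) / E^((q+1)M), with q = 64 f, is a supermartingale
      ([degpot_drift]), and the average degree gets close to 1 while E is still at
      least E0 = N / (8 Dl^q), up to an exponentially small probability.
    - When the average degree is close to 1, there are many dead edges or a
      positive proportion of the copies are lone ([pot_sparse]).
    - No copy is lone at the start.  If the removal of C makes P lone, then P met
      some copy D just before, and C meets D but not P.  Unless P lies near a
      cycle of copies, this D is unique.  It was as likely to be chosen as C, and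
      choosing it would have destroyed P and left dead an edge of P ([aloneD]).
      So lone copies cannot appear in number without dead edges appearing too:
      2^-#dead (1 - b)^-#lone is a supermartingale for a small b
      ([lonepot_drift]).
    Both potentials depend on the current state only.  Their weighted sum [pot]
    bounds the probability to end with few dead edges ([greedy_fail]).

    Cycles of copies are rare.  Give an edge set B the weight
    (f - 1) |V(B)| - (m - k) |B|.  The weight is submodular; one edge and a whole
    copy of F have the same weight w0, and strict k-balancedness says that the
    edge sets strictly between them are heavier.  So two copies that share two
    edges, or a cycle of copies, contain an edge set lighter than w0
    ([overlap_light], [cycle_light]).  A smallest edge set lighter than w0 is a
    strictly balanced template with empty root ([light_balanced]), and
    boundedness allows only N n^-c copies of it, with c > 0 depending on F alone
    ([card_bad_edges], [light_le]).  As all degrees are at most n^(eps^3), only a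
    negligible number of copies lies near such an edge set ([card_near_bad]).
    *)

Set Implicit Arguments.
Unset Strict Implicit.
Unset Printing Implicit Defensive.
Import Order.TTheory GRing.Theory Num.Theory.
Local Open Scope ring_scope.

(** * Elementary inequalities *)

Section Arithmetic.
Variable R : realFieldType.

Lemma inv_bound (x : R) : 0 <= x -> x <= 4^-1 -> 1 <= (1 + 2 * x) * (1 - x).
Proof.
move=> x0 x1; have -> : (1 + 2 * x) * (1 - x) = 1 + x * (1 - 2 * x) by ring.
by rewrite lerDl mulr_ge0 //; lra.
Qed.

Lemma half_bound (y z : R) : 1 <= y -> y <= 1 + z -> 2^-1 * y <= 1 + z - 2^-1.
Proof. lra. Qed.

Lemma quarter_bound (x y : R) : x <= 4^-1 * y -> 2 * x - 2^-1 * y <= 0.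
Proof. lra. Qed.

(** The drift of the number of copies.  Here [F] is the number f of edges of a
    copy, [D] and [E] are the numbers of copies and of edges, [Hs] sums over all
    copies the number of copies that its removal destroys, and [Q2] sums the
    squared degrees.  By Cauchy-Schwarz [Q2] is at least (F D)^2 / E, so that an
    average step destroys about 1 + F (d - 1) copies, where d = F D / E.  For
    d >= 1 + eta and F >= 3 this beats the proportional loss d by a factor
    of at least 1 + eta / 2; [err] accounts for copies that overlap in more than
    one edge, and the factor 1 - eta / 8 for the second order term. *)
Lemma drift_bound (F D E eta Hs Q2 err : R) : 3 <= F -> F * eta = 16^-1 ->
  0 < D -> 0 < E -> (1 + eta) * E <= F * D -> err <= eta / 2 * D ->
  (F * D) ^+ 2 <= E * Q2 -> D + Q2 <= Hs + F * D + err ->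
  (1 + eta / 4) * (F * D / E) <= (1 - eta / 8) * (Hs / D).
Proof.
move=> F3 Feta D0 E0 hd herr hQ hH.
have eta0 : 0 < eta by rewrite -(pmulr_rgt0 _ (_ : 0 < F)) ?Feta ?invr_gt0 //; lra.
have eta1 : eta <= 48^-1 by nra.
pose d := F * D / E.
have d1 : 1 + eta <= d by rewrite /d ler_pdivlMr.
have hQ' : d * F * D <= Q2.
  have dE : E * (d * F * D) = (F * D) ^+ 2 by rewrite /d; field; rewrite gt_eqF.
  by rewrite -(ler_pM2l E0) dE.
rewrite -/d; have sxge : 1 + F * d - F - eta / 2 <= Hs / D.
  by rewrite ler_pdivlMr //; clear d1; move: d hQ' => d hQ'; nra.
move: (Hs / D) sxge d1 => sx; move: d {hQ'} => d sxge d1.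
have h1 : 0 <= (F - 3) * (d - 1) by rewrite mulr_ge0; lra.
have h2 : 0 <= (d - 1) * (1 - eta / 2) by rewrite mulr_ge0; lra.
have h3 : (1 + eta / 2) * d <= sx by lra.
apply: le_trans (_ : (1 - eta / 8) * ((1 + eta / 2) * d) <= _); last first.
  by rewrite ler_wpM2l //; lra.
rewrite mulrA ler_wpM2r //; first by lra.
have h4 : 0 <= eta * (1 / 8 - eta / 16) by rewrite mulr_ge0; lra.
lra.
Qed.

Lemma exponent_split (F e y : R) :
  64 * F * y * (1 + e / 4) = 64 * F * y + 16 * (F * e) * y.
Proof. by field. Qed.

(** With [F] edges per copy, [E] edges, [D] copies, [L] lone copies, of which at
    most [bt] are excluded, and [a] dead edges: when the average degree is below
    1 + eta and few edges are dead, almost all edges lie in exactly one copy, so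
    the number [al] of remaining lone copies is a positive proportion of E / F. *)
Lemma lone_bound (F E D L a al bt j eta : R) : 3 <= F -> F * eta = 16^-1 ->
  0 <= E -> D + 2 * E <= L + 2 * (F * D + a) -> L <= al + bt -> a <= eta * E ->
  E - a <= F * D -> bt * F <= E / 16 -> 8 * F * j <= 2 * E ->
  F * D < (1 + eta) * E -> j <= al.
Proof.
move=> F3 Feta E0 h1 h2 ha hD hb hj hs.
have F0 : 0 < F by lra.
have h : D - 4 * (eta * E) - bt <= al by lra.
have FeE : F * (eta * E) = E / 16 by rewrite mulrA Feta mulrC.
have eE : 0 <= eta * E by rewrite -(pmulr_rge0 _ F0) FeE divr_ge0.
have e3 : 3 * (eta * E) <= F * (eta * E) by rewrite ler_wpM2r.
rewrite -(ler_pM2l F0); have := ler_wpM2l (ltW F0) h.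
rewrite !mulrBr [F * (4 * _)]mulrCA FeE [F * bt]mulrC; lra.
Qed.

Lemma double_bound (F E E0 : R) : 2 * F <= E0 -> E0 - F <= E -> E0 <= 2 * E.
Proof. lra. Qed.

Lemma binomial_step (z u : R) : 0 <= z -> z <= u -> 1 - z + z ^+ 2 <= 1 - z * (1 - u).
Proof.
move=> z0 zu; have h : 0 <= z * (u - z) by rewrite mulr_ge0 // subr_ge0.
by rewrite -subr_ge0 (_ : _ - _ = z * (u - z)) //; ring.
Qed.

Lemma bernoulli_ge (x : R) n : 0 <= x <= 1 -> 1 - n%:R * x <= (1 - x) ^+ n.
Proof.
move=> /andP[x0 x1]; elim: n => [|n IH]; first by rewrite mul0r subr0 expr0.
have h := ler_wpM2l (_ : 0 <= 1 - x) IH; rewrite exprS; apply: le_trans (h _); last by lra.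
have n0 : 0 <= n%:R :> R by [].
rewrite -natr1; nra.
Qed.

(** The expansion to second order, which holds without any bound on [n * x]. *)
Lemma bernoulli_le (x : R) n : 0 <= x <= 1 ->
  (1 - x) ^+ n <= 1 - n%:R * x + (n%:R * x) ^+ 2.
Proof.
move=> /andP[x0 x1]; elim: n => [|n IH]; first by rewrite mul0r expr0n /= subr0 addr0 expr0.
have h := ler_wpM2l (_ : 0 <= 1 - x) IH; rewrite exprS; apply: le_trans (h _) _; first by lra.
have n0 : 0 <= n%:R :> R by [].
rewrite -natr1 -subr_ge0.
have -> : 1 - (n%:R + 1) * x + ((n%:R + 1) * x) ^+ 2
   - (1 - x) * (1 - n%:R * x + (n%:R * x) ^+ 2) =
  (n%:R + 1) * x ^+ 2 + n%:R ^+ 2 * x ^+ 3 :> R by ring.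
by rewrite addr_ge0 // mulr_ge0 ?addr_ge0 ?exprn_ge0.
Qed.

(** Cauchy-Schwarz, through the variance of [d] on [A]. *)
Lemma cauchy_sum (T : finType) (A : {pred T}) (d : T -> nat) :
  ((\sum_(e in A) d e)%:R) ^+ 2 <= #|A|%:R * ((\sum_(e in A) d e ^ 2)%N)%:R :> R.
Proof.
have [A0|A0] := posnP #|A|.
  by rewrite !big_pred0 ?expr0n ?mulr0 // => e; rewrite (card0_eq A0).
set E : R := #|A|%:R; have E0 : 0 < E by rewrite ltr0n.
set s := (\sum_(e in A) d e)%N; set s2 := (\sum_(e in A) d e ^ 2)%N.
pose t : R := s%:R / E.
have : 0 <= \sum_(e in A) ((d e)%:R - t) ^+ 2 by apply: sumr_ge0 => e _; exact: sqr_ge0.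
have -> : \sum_(e in A) ((d e)%:R - t) ^+ 2 = s2%:R - 2 * t * s%:R + E * t ^+ 2.
  rewrite /s2 /s !natr_sum mulr_sumr -sumrB /E -sum1_card natr_sum mulr_suml -big_split /=.
  by apply: eq_bigr => e _; rewrite natrX; ring.
have -> : s2%:R - 2 * t * s%:R + E * t ^+ 2 = s2%:R - s%:R ^+ 2 / E.
  by rewrite /t; field; rewrite gt_eqF.
by rewrite subr_ge0 ler_pdivrMr // mulrC.
Qed.
End Arithmetic.

(** * The random greedy matching of a uniform hypergraph *)

Lemma card_bigcup_le (I T : finType) (P : pred I) (G : I -> {set T}) :
  (#|\bigcup_(i | P i) G i| <= \sum_(i | P i) #|G i|)%N.
Proof.
apply: (big_rec2 (fun (A : {set T}) n => (#|A| <= n)%N)); first by rewrite cards0.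
move=> i n A _ le; apply: (leq_trans (leq_card_setU _ _)).
by rewrite leq_add2l.
Qed.

Lemma card_bigcup_leM (I T : finType) (P : pred I) (G : I -> {set T}) (a b : nat) :
  (#|P| <= a)%N -> (forall i, P i -> (#|G i| <= b)%N) ->
  (#|\bigcup_(i | P i) G i| <= a * b)%N.
Proof.
move=> Pa Gb; apply: leq_trans (card_bigcup_le P G) _.
apply: leq_trans (_ : (\sum_(i | P i) b <= _)%N); first exact: leq_sum.
by rewrite sum_nat_const leq_mul.
Qed.

Section GreedyMatching.
Variables (X : finType) (cc : {set {set X}}).

(** [cc] is the family of all hyperedges; those inside the set [S] of uncovered
    vertices can still be chosen. *)
Definition live (S : {set X}) : {set {set X}} := [set C in cc | C \subset S].

Definition deg (S : {set X}) (e : X) : nat := #|[set C in live S | e \in C]|.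

Definition dead (S : {set X}) : {set X} := [set e in S | deg S e == 0%N].

Definition meeting (S C : {set X}) : {set {set X}} :=
  [set D in live S | ~~ [disjoint D & C]].

Definition lone (S : {set X}) : {set {set X}} :=
  [set C in live S | [forall D in live S, (D != C) ==> [disjoint D & C]]].

Lemma in_live (S C : {set X}) : (C \in live S) = (C \in cc) && (C \subset S).
Proof. by rewrite in_set. Qed.

Lemma in_liveD (S C D : {set X}) :
  (D \in live (S :\: C)) = (D \in live S) && [disjoint D & C].
Proof. by rewrite !inE subsetD -andbA. Qed.

Lemma card_liveD (S C : {set X}) :
  (#|live (S :\: C)| + #|meeting S C| = #|live S|)%N.
Proof.
rewrite -(cardsID (meeting S C) (live S)) addnC; congr (_ + _)%N.
  by apply: eq_card => D; rewrite !inE; case: (D \in cc); case: (D \subset S).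
by apply: eq_card => D; rewrite !inE subsetD; case: (D \in cc); case: (D \subset S); case: [disjoint _ & _].
Qed.

Lemma deg_liveD (S C : {set X}) e : (deg (S :\: C) e <= deg S e)%N.
Proof.
apply/subset_leq_card/subsetP=> D; rewrite !in_set => /andP[/andP[-> DS] ->].
by rewrite (subset_trans DS (subsetDl _ _)).
Qed.

Lemma sub_dead (S C : {set X}) : C \in live S -> dead S \subset dead (S :\: C).
Proof.
move=> CS; apply/subsetP=> e; rewrite !in_set => /andP[eS de].
rewrite eS andbT -leqn0 (leq_trans (deg_liveD _ _ _)) ?(eqP de) // andbT.
apply: contraTN de => eC; rewrite -lt0n card_gt0; apply/set0Pn; exists C.
by rewrite inE CS.
Qed.

(** When the process stops, every uncovered vertex is dead: the quantity to be
    bounded from below is the final number of dead vertices. *)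
Lemma dead_terminal (S : {set X}) : live S = set0 -> dead S = S.
Proof.
move=> L0; apply/setP=> e; rewrite inE /deg L0.
by rewrite eq_card0 ?andbT // => C; rewrite !inE.
Qed.

Lemma deg_ge1 (S C : {set X}) e : C \in live S -> e \in C -> (0 < deg S e)%N.
Proof. by move=> CS eC; rewrite card_gt0; apply/set0Pn; exists C; rewrite inE CS. Qed.

Variable f : nat.
Hypothesis unif : forall C, C \in cc -> #|C| = f.

Lemma sum_deg (S : {set X}) : (\sum_(e in S) deg S e = f * #|live S|)%N.
Proof.
rewrite mulnC -sum_nat_const.
under eq_bigr => e _ do rewrite /deg -sum1dep_card.
rewrite (exchange_big_dep (fun D => D \in live S)) /=; last by move=> e C _ /andP[].
apply: eq_bigr => C; rewrite in_live => /andP[CC CS].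
rewrite -(unif CC) -sum1_card; apply: eq_bigl => e.
rewrite CC CS /=; case eC: (e \in C); rewrite ?andbF ?andbT //.
exact: (subsetP CS).
Qed.

Lemma sum_deg2 (S : {set X}) :
  (\sum_(C in live S) \sum_(e in C) deg S e = \sum_(e in S) deg S e ^ 2)%N.
Proof.
rewrite (exchange_big_dep (fun e => e \in S)) /=; last first.
  by move=> C e; rewrite in_live => /andP[_ /subsetP]; apply.
apply: eq_bigr => e eS; rewrite sum_nat_const -mulnn; congr (_ * _)%N.
by rewrite /deg cardsE.
Qed.

Variable Dl : nat.
Hypothesis degb : forall S e, (deg S e <= Dl)%N.

Lemma card_meeting_le (S C : {set X}) :
  C \in cc -> (#|meeting S C| <= f * Dl)%N.
Proof.
move=> CC; rewrite -(unif CC) -sum_nat_const.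
apply: (@leq_trans (\sum_(e in C) deg S e)%N); last by apply: leq_sum.
rewrite -sum1_card.
under [X in (_ <= X)%N]eq_bigr => e _ do rewrite /deg -sum1dep_card.
rewrite (exchange_big_dep (fun D => D \in live S)) /=; last by move=> e D _ /andP[].
rewrite [X in (_ <= X)%N](big_setID (meeting S C)) /= (leq_trans _ (leq_addr _ _)) //.
rewrite (_ : live S :&: meeting S C = meeting S C); last first.
  by apply/setIidPr/subsetP=> D; rewrite inE => /andP[].
apply: leq_sum => D; rewrite inE => /andP[DS].
rewrite disjoint_sym disjoint_subset => /subsetPn[e eC /=]; rewrite !inE negbK => eD.
by rewrite (bigD1 e) //= eC eD -in_live DS.
Qed.

Variable Dg : {set {set X}}.
(** [Dg] collects the hyperedges with an untypical neighbourhood. *)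
Hypothesis lin : forall C D, C \in cc -> C \notin Dg -> D \in cc -> D != C ->
  (#|C :&: D| <= 1)%N.

Hypothesis f3 : (2 < f)%N.

Lemma meeting_self (S C : {set X}) : C \in live S -> C \in meeting S C.
Proof.
move=> CS; rewrite in_set CS -setI_eq0 setIid -card_gt0 unif ?(ltn_trans _ f3) //.
by move: CS; rewrite in_live => /andP[].
Qed.

(** As [C] meets every other hyperedge in at most one vertex, the hyperedges
    other than [C] through the different vertices of [C] are distinct. *)
Lemma meeting_lower_lin (S C : {set X}) : C \in live S -> C \notin Dg ->
  (1 + \sum_(e in C) deg S e <= #|meeting S C| + f)%N.
Proof.
move=> CS CD; have /andP[CC sCS] : (C \in cc) && (C \subset S) by move: CS; rewrite inE.
under eq_bigr => e _ do rewrite /deg -sum1dep_card.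
rewrite (exchange_big_dep (fun D => D \in live S)) /=; last by move=> e D _ /andP[].
rewrite (bigD1 C) //= addnCA addnC leq_add //; last first.
  rewrite -(unif CC) -sum1_card; apply: eq_leq; apply: eq_bigl => e.
  by move: CS; rewrite in_live => ->; rewrite andbb.
rewrite [in X in (_ <= X)%N](cardD1 C) meeting_self // leq_add // -sum1_card.
rewrite [X in (_ <= X)%N](eq_bigl (fun D => ((D \in live S) && (D != C)) &&
   ~~ [disjoint D & C])); last first.
  by move=> D; rewrite inE /= in_set andbA [(D != C) && _]andbC.
rewrite [X in (_ <= X)%N]big_mkcondr; apply: leq_sum => D /andP[DS DC].
have DD : D \in cc by move: DS; rewrite in_live => /andP[].
have -> : (\sum_(e in C | (D \in live S) && (e \in D)) 1 = #|C :&: D|)%N.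
  by rewrite sum1dep_card; apply: eq_card => e; rewrite !inE DD; move: DS; rewrite in_live => /andP[_ ->].
have := lin CC CD DD DC; rewrite setIC -setI_eq0.
by case: eqP => [->|]; rewrite ?cards0.
Qed.

Lemma meeting_lower (S C : {set X}) : C \in live S ->
  (1 + \sum_(e in C) deg S e <= #|meeting S C| + f + (C \in Dg) * (f * Dl))%N.
Proof.
move=> CS; have CC : C \in cc by move: CS; rewrite in_live => /andP[].
have [CD|CD] /= := boolP (C \in Dg); last by rewrite addn0 meeting_lower_lin.
have h1 : (0 < #|meeting S C|)%N.
  by rewrite card_gt0; apply/set0Pn; exists C; apply: meeting_self.
have h2 : (\sum_(e in C) deg S e <= f * Dl)%N.
  by rewrite -(unif CC) -sum_nat_const; apply: leq_sum.
lia.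
Qed.

Variable beta : nat.
Hypothesis betaP : (#|cc :&: Dg| <= beta)%N.

(** A hyperedge is destroyed by each of its neighbours, so the left side grows
    with the sum of the squared degrees; this is where convexity enters. *)
Lemma sum_meeting (S : {set X}) :
  (#|live S| + \sum_(e in S) deg S e ^ 2
   <= \sum_(C in live S) #|meeting S C| + f * #|live S| + f * Dl * beta)%N.
Proof.
rewrite -sum_deg2 -sum1_card -big_split /=.
apply: leq_trans (_ : (\sum_(C in live S) (#|meeting S C| + f + (C \in Dg) * (f * Dl)) <= _)%N).
  by apply: leq_sum => C CS; apply: meeting_lower.
rewrite !big_split /= -big_distrl /= leq_add //.
  by rewrite leq_add // sum_nat_const sum1_card mulnC.
rewrite mulnC leq_mul // (leq_trans _ betaP) //.
rewrite -big_mkcondr sum1dep_card; apply/subset_leq_card/subsetP => C.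
by rewrite !inE => /andP[/andP[-> _] ->].
Qed.

Hypothesis cyc : forall P A B C, [/\ P \in cc, A \in cc, B \in cc & C \in cc] ->
  P \notin Dg -> A != B -> [disjoint P & C] -> 
  ~~ [disjoint A & P] -> ~~ [disjoint B & P] -> 
  ~~ [disjoint A & C] -> ~~ [disjoint B & C] -> False.

Definition alone (S : {set X}) := lone S :\: Dg.

Definition killers (S : {set X}) :=
  [set D in live S | (#|dead S| < #|dead (S :\: D)|)%N].

(** Suppose that choosing [C] makes [P] lone.  A neighbour [D] of [P] must be
    destroyed by [C], hence meets [C]; there is only one such [D], by the absence
    of 4-cycles.  So a vertex of [P] outside [D] lies in no hyperedge disjoint
    from [D], and choosing [D] instead of [C] leaves it dead. *)
Lemma aloneD (S C P : {set X}) : C \in live S ->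
  P \in alone (S :\: C) :\: alone S ->
  exists2 D, D \in killers S :&: meeting S C & P \in meeting S D.
Proof.
move=> CS; rewrite in_setD => /andP[nPS]; rewrite in_setD => /andP[PD].
rewrite inE => /andP[]; rewrite in_liveD => /andP[PS PC] /forall_inP Plone.
have ccS D : D \in live S -> D \in cc by rewrite inE => /andP[].
move: nPS; rewrite in_setD PD /= inE PS /= => /forall_inPn[D DS].
rewrite negb_imply => /andP[DP DmP].
have meetC A : A \in live S -> A != P -> ~~ [disjoint A & P] -> ~~ [disjoint A & C].
  move=> AS AP; apply: contra => AC.
  by have := Plone A; rewrite in_liveD AS AC AP => /(_ isT).
have DC := meetC D DS DP DmP.
exists D; last by rewrite in_set PS disjoint_sym.
rewrite in_setI [D \in meeting _ _]in_set [D \in killers _]in_set DC DS !andbT /=.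
(* P and D are distinct and have the same size. *)
have [e eP eD] : exists2 e, e \in P & e \notin D.
  apply/subsetPn; apply: contra DP => sPD; rewrite eq_sym eqEcard sPD.
  by rewrite (unif (ccS _ PS)) (unif (ccS _ DS)) leqnn.
apply/proper_card/properP; split; first exact: sub_dead.
have eS : e \in S by move: PS; rewrite in_live => /andP[_ /subsetP->].
exists e; last first.
  by rewrite in_set eS /= -lt0n (deg_ge1 PS eP).
rewrite !in_set eS eD /= cards_eq0; apply/eqP/setP=> A; rewrite in_set0.
apply/negP; rewrite inE in_liveD => /andP[/andP[AS AD] eA].
have [AP|AP] := eqVneq A P; first by rewrite AP disjoint_sym (negPf DmP) in AD.
have AmP : ~~ [disjoint A & P].
  by apply/negP=> /disjointFr /(_ eA); rewrite eP.
have AneD : A != D.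
  by apply: contraNneq eD => <-.
by apply: (@cyc P A D C); rewrite ?ccS ?meetC.
Qed.

Definition freed (S C : {set X}) := alone (S :\: C) :\: alone S.

Lemma card_freed_sum (S C : {set X}) : C \in live S ->
  (#|freed S C| <= \sum_(D in killers S | D \in meeting S C) f * Dl)%N.
Proof.
move=> CS.
apply: leq_trans (_ : (\sum_(D in killers S | D \in meeting S C) #|meeting S D| <= _)%N).
  apply: leq_trans (_ : (#|\bigcup_(D in killers S | D \in meeting S C) meeting S D| <= _)%N).
    apply/subset_leq_card/subsetP => P /(aloneD CS)[D]; rewrite in_setI => /andP[Dk Dm] PD.
    by apply/bigcupP; exists D; rewrite ?Dk.
  exact: card_bigcup_le.
apply: leq_sum => D /andP[]; rewrite inE => /andP[DS _] _.
by apply: card_meeting_le; move: DS; rewrite in_live => /andP[].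
Qed.

Lemma card_freed (S C : {set X}) : C \in live S -> (#|freed S C| <= (f * Dl) ^ 2)%N.
Proof.
move=> CS; apply: leq_trans (card_freed_sum CS) _.
rewrite sum_nat_const -mulnn leq_mul //.
have CC : C \in cc by move: CS; rewrite in_live => /andP[].
apply: leq_trans (card_meeting_le S CC).
by apply/subset_leq_card/subsetP => D /andP[].
Qed.

(** Double counting of the pairs (C, P) such that choosing [C] makes [P] lone:
    by [aloneD] each of them passes through a killer that meets both. *)
Lemma sum_freed (S : {set X}) :
  (\sum_(C in live S) #|freed S C| <= #|killers S| * (f * Dl) ^ 2)%N.
Proof.
apply: leq_trans (_ : (\sum_(C in live S)
   \sum_(D in killers S | D \in meeting S C) f * Dl <= _)%N).
  by apply: leq_sum => C; apply: card_freed_sum.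
rewrite (exchange_big_dep (fun D => D \in killers S)) /=; last by move=> C D _ /andP[].
rewrite -sum_nat_const; apply: leq_sum => D Dk.
have DS : D \in live S by move: Dk; rewrite inE => /andP[].
have DC : D \in cc by move: DS; rewrite in_live => /andP[].
rewrite sum_nat_const -mulnn leq_mul //.
apply: leq_trans (card_meeting_le S DC); apply/subset_leq_card/subsetP => C.
rewrite unfold_in /= => /andP[CS /andP[_]].
rewrite [D \in _]in_set [C \in meeting _ _]in_set DS CS /=.
by rewrite disjoint_sym.
Qed.

Lemma not_lone_deg (S C : {set X}) : C \in live S -> C \notin lone S ->
  exists2 e, e \in C & (2 <= deg S e)%N.
Proof.
move=> CS; rewrite in_set CS /= => /forall_inPn[D DS].
rewrite negb_imply => /andP[DC]; rewrite disjoint_subset => /subsetPn[e eD].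
rewrite !inE negbK => eC; exists e => //.
rewrite /deg (cardsD1 C) (cardsD1 D) in_setD1 !in_set -!in_live CS DS eC eD DC.
by [].
Qed.

(** A hyperedge that is not lone has a vertex of degree at least 2, and the total
    degree of these vertices is at most twice the sum over all vertices of
    degree - 1, where dead vertices count 0. *)
Lemma card_live_lone (S : {set X}) :
  (#|live S| + 2 * #|S| <= #|lone S| + 2 * (f * #|live S| + #|dead S|))%N.
Proof.
have sumpred : (\sum_(e in S) (deg S e).-1 + #|S| = f * #|live S| + #|dead S|)%N.
  have -> : (#|dead S| = \sum_(e in S) (deg S e == 0%N))%N.
    by rewrite /dead -sum1dep_card big_mkcondr; apply: eq_bigr => e _; case: eqP.
  rewrite -sum_deg -sum1_card -!big_split /=; apply: eq_bigr => e _.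
  by case: (deg S e) => //= n; lia.
have sub : (#|live S :\: lone S| <= 2 * \sum_(e in S) (deg S e).-1)%N.
  apply: leq_trans (_ : (\sum_(e in S | (2 <= deg S e)%N) deg S e <= _)%N); last first.
    rewrite big_distrr /= big_mkcondr; apply: leq_sum => e _.
    by case: (deg S e) => [|[|n]] //=; lia.
  rewrite /deg -sum1_card.
  under [X in (_ <= X)%N]eq_bigr => e _ do rewrite -sum1dep_card.
  rewrite (exchange_big_dep (fun D => D \in live S)) /=; last by move=> e D _ /andP[].
  rewrite [X in (_ <= X)%N](bigID (fun D => D \in live S :\: lone S)) /=.
  rewrite (leq_trans _ (leq_addr _ _)) //.
  rewrite [X in (_ <= X)%N](eq_bigl (fun D => D \in live S :\: lone S)); last first.
    by move=> D; rewrite in_setD; case: (D \in live S); rewrite ?andbF.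
  apply: leq_sum => D; rewrite in_setD => /andP[Dl' DS].
  have [e eD e2] := not_lone_deg DS Dl'.
  have eS : e \in S by move: DS; rewrite in_live => /andP[_ /subsetP->].
  by rewrite (bigD1 e) //= eS e2 eD DS.
have := cardsID (lone S) (live S).
rewrite (_ : live S :&: lone S = lone S); last first.
  by apply/setIidPr/subsetP=> D; rewrite inE => /andP[].
lia.
Qed.

Lemma card_alone (S : {set X}) : (#|lone S| <= #|alone S| + beta)%N.
Proof.
rewrite -(cardsID Dg (lone S)) addnC leq_add // (leq_trans _ betaP) //.
apply/subset_leq_card/subsetP=> C; rewrite in_setI inE => /andP[/andP[CS _] CD].
by rewrite in_setI CD andbT; move: CS; rewrite in_live => /andP[].
Qed.

(** * Potential functions of the greedy matching *)

Variable R : realType.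
Hypothesis Dl0 : (0 < Dl)%N.

Let fD : R := (f * Dl)%:R.

Lemma fD_gt0 : 0 < fD.
Proof. by rewrite ltr0n muln_gt0 Dl0 andbT (leq_trans _ f3). Qed.

(** Small enough for the gain of [lonepot] at killers to pay for all the lone
    hyperedges of [sum_freed]. *)
Definition lone_rate : R := 4^-1 / fD ^+ 2.

Lemma lone_rate_gt0 : 0 < lone_rate.
Proof. by rewrite divr_gt0 ?invr_gt0 ?ltr0n // exprn_gt0 // fD_gt0. Qed.

Lemma lone_rateM : lone_rate * fD ^+ 2 = 4^-1.
Proof. by rewrite /lone_rate divfK // expf_neq0 // gt_eqF ?fD_gt0. Qed.

Lemma lone_rate_lt1 : lone_rate < 1.
Proof.
have h : 1 <= fD ^+ 2 by rewrite exprn_ege1 // ler1n muln_gt0 Dl0 andbT (leq_trans _ f3).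
rewrite -(ltr_pM2r (_ : 0 < fD ^+ 2)) ?(lt_le_trans _ h) // lone_rateM mul1r.
by rewrite (lt_le_trans _ h) // invf_lt1 ?ltr1n.
Qed.

(** Large only if there are many lone hyperedges and few dead vertices. *)
Definition lonepot (S : {set X}) : R :=
  (2^-1) ^+ #|dead S| * ((1 - lone_rate)^-1) ^+ #|alone S|.

Lemma lonepot_step (S C : {set X}) : C \in live S ->
  lonepot (S :\: C) <= lonepot S *
    (1 + 2 * lone_rate * #|freed S C|%:R - 2^-1 * (C \in killers S)%:R).
Proof.
move=> CS; rewrite /lonepot; set g := (1 - lone_rate)^-1.
have b0 := lone_rate_gt0; have b1 := lone_rate_lt1.
have g1 : 1 <= g by rewrite invf_ge1 ?subr_gt0 // gerBl ltW.
set I := #|freed S C|; set K := (C \in killers S) : nat.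
have dS : (#|dead S| + K <= #|dead (S :\: C)|)%N.
  rewrite /K; case: (boolP (C \in killers S)) => [|_].
    by rewrite in_set => /andP[_]; rewrite addn1.
  by rewrite addn0 subset_leq_card // sub_dead.
have aS : (#|alone (S :\: C)| <= #|alone S| + I)%N.
  rewrite -(cardsID (alone S) (alone (S :\: C))) leq_add2r.
  by apply/subset_leq_card/subsetP => D; rewrite in_setI => /andP[].
have h2 : g ^+ I <= 1 + 2 * lone_rate * I%:R.
  have Ile : I%:R <= fD ^+ 2 by rewrite -natrX ler_nat card_freed.
  have bI : lone_rate * I%:R <= 4^-1 by rewrite -lone_rateM ler_wpM2l // ltW.
  have bI0 : 0 <= lone_rate * I%:R by rewrite mulr_ge0 // ltW.
  have hb : 1 - I%:R * lone_rate <= (1 - lone_rate) ^+ I by apply: bernoulli_ge; rewrite !ltW.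
  have p0 : 0 < (1 - lone_rate) ^+ I by rewrite exprn_gt0 // subr_gt0.
  rewrite /g exprVn -[X in X <= _]mul1r ler_pdivrMr //.
  apply: le_trans (_ : (1 + 2 * lone_rate * I%:R) * (1 - I%:R * lone_rate) <= _).
    by rewrite -mulrA [I%:R * _]mulrC inv_bound.
  by rewrite ler_wpM2l // addr_ge0 // -mulrA mulr_ge0.
have h2' : 1 <= g ^+ I by rewrite exprn_ege1.
have g0 : 0 <= g by apply: le_trans g1.
have hf0 : 0 <= 2^-1 :> R by rewrite invr_ge0.
apply: le_trans (_ : (2^-1) ^+ (#|dead S| + K) * g ^+ (#|alone S| + I) <= _).
  apply: ler_pM; rewrite ?exprn_ge0 //; last exact: ler_weXn2l.
  by apply: ler_wiXn2l => //; rewrite invf_le1 ?ler1n.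
rewrite !exprD mulrACA; apply: ler_wpM2l; first by rewrite mulr_ge0 ?exprn_ge0.
rewrite /K; case: (C \in killers S); last by rewrite expr0 mul1r mulr0 subr0.
by rewrite expr1 mulr1 half_bound.
Qed.

(** On average over [C], the expected increase through new lone hyperedges, which
    is bounded by [sum_freed], is compensated by the factor 1/2 that each killer
    contributes. *)
Lemma lonepot_drift (S : {set X}) :
  \sum_(C in live S) lonepot (S :\: C) <= #|live S|%:R * lonepot S.
Proof.
apply: le_trans (ler_sum _ (fun C CS => lonepot_step CS)) _.
have l0 : 0 <= lonepot S.
  by rewrite mulr_ge0 // exprn_ge0 ?invr_ge0 // subr_ge0 ltW // lone_rate_lt1.
rewrite -mulr_sumr mulrC ler_wpM2r //.
rewrite sumrB big_split /= -!mulr_sumr sumr_const.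
rewrite -addrA gerDl -natr_sum -natr_sum.
have -> : (\sum_(C in live S) (C \in killers S) = #|killers S|)%N.
  rewrite -big_mkcondr sum1dep_card; apply: eq_card => C.
  rewrite in_set; case K: (C \in killers S); rewrite ?andbF ?andbT //.
  by move: K; rewrite in_set => /andP[].
have h := sum_freed S; rewrite -(ler_nat R) natrM natrX -/fD in h.
have := lone_rateM; have := lone_rate_gt0 => b0 bM.
rewrite -mulrA quarter_bound // (le_trans (ler_wpM2l (ltW b0) h)) //.
by rewrite mulrCA bM mulrC.
Qed.

Variables (M : nat).

(** The exponents 64 f and 64 f + 1 are in the ratio 1 + eta / 4 for
    eta = 1 / (16 f); [M] amplifies the supermartingale, which turns Markov's
    inequality into an exponential bound. *)
Definition degpot (S : {set X}) : R :=
  #|live S|%:R ^+ (64 * f * M) / #|S|%:R ^+ ((64 * f).+1 * M).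

Lemma card_setD_live (S C : {set X}) : C \in live S -> (#|S :\: C| + f = #|S|)%N.
Proof.
rewrite in_live => /andP[CC CS]; rewrite -(unif CC) -(cardsID C S) addnC.
by rewrite (setIidPr CS).
Qed.

(** With x the proportion of the copies and y the proportion of the edges that
    a step removes, the claim is that the average of (1 - x)^K is at most
    (1 - y)^T, where K = 64 f M and T = (64 f + 1) M.  The first is at most
    1 - K (1 - eta / 8) x on average, because K x <= eta / 8 makes the second
    order term small, and the second is at least 1 - T y. *)
Lemma degpot_drift (S : {set X}) (eta := (16 * f%:R)^-1 : R) :
  (f < #|S|)%N ->
  (1 + eta) * #|S|%:R <= f%:R * #|live S|%:R ->
  (f * Dl * beta)%:R <= eta / 2 * #|live S|%:R ->
  (64 * f * M * (f * Dl))%:R <= eta / 8 * #|live S|%:R ->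
  \sum_(C in live S) degpot (S :\: C) <= #|live S|%:R * degpot S.
Proof.
move=> fS hd herr hk.
set D : R := #|live S|%:R; set E : R := #|S|%:R; set F : R := f%:R.
have F3 : 3 <= F by rewrite ler_nat.
have eta0 : 0 < eta by rewrite invr_gt0 mulr_gt0 // (lt_le_trans _ F3).
have Feta : F * eta = 16^-1 by rewrite /eta -/F; field; rewrite gt_eqF // (lt_le_trans _ F3).
have E0 : 0 < E by rewrite ltr0n (leq_trans _ fS).
have EF : F < E by rewrite ltr_nat.
have D0 : 0 < D.
  have : 0 < F * D by apply: lt_le_trans hd; rewrite mulr_gt0 // addr_gt0.
  by rewrite pmulr_rgt0 // (lt_le_trans _ F3).
pose x C : R := #|meeting S C|%:R / D.
pose y : R := F / E.
set K := (64 * f * M)%N; set T := ((64 * f).+1 * M)%N.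
have x01 C : 0 <= x C <= 1.
  rewrite divr_ge0 ?ler0n //= /x ler_pdivrMr // mul1r ler_nat.
  by apply/subset_leq_card/subsetP => A; rewrite in_set => /andP[].
have y01 : 0 <= y <= 1 by rewrite /y divr_ge0 ?ler0n //= ler_pdivrMr // mul1r ltW.
have step C : C \in live S ->
    degpot (S :\: C) = degpot S * ((1 - x C) ^+ K / (1 - y) ^+ T).
  move=> CS; rewrite /degpot.
  have -> : #|live (S :\: C)|%:R = D * (1 - x C).
    rewrite mulrBr mulr1 /x [D * (_ / _)]mulrCA divff ?gt_eqF // mulr1.
    by rewrite /D -(card_liveD S C) natrD addrK.
  have -> : #|S :\: C|%:R = E * (1 - y).
    rewrite mulrBr mulr1 /y [E * (_ / _)]mulrCA divff ?gt_eqF // mulr1.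
    by rewrite /E -(card_setD_live CS) natrD addrK.
  by rewrite !exprMn invfM mulrACA.
rewrite (eq_bigr _ step) -mulr_sumr mulrC ler_wpM2r //.
  by rewrite divr_ge0 ?exprn_ge0.
rewrite -mulr_suml ler_pdivrMr; last first.
  by rewrite exprn_gt0 // subr_gt0 /y ltr_pdivrMr // mul1r.
pose sx := \sum_(C in live S) x C.
have kap C : C \in live S -> K%:R * x C <= eta / 8.
  move=> CS; have CC : C \in cc by move: CS; rewrite in_live => /andP[].
  rewrite /x mulrA ler_pdivrMr // (le_trans _ hk) // -natrM ler_nat.
  by rewrite leq_mul // card_meeting_le.
have hx : \sum_(C in live S) (1 - x C) ^+ K <= D - K%:R * (1 - eta / 8) * sx.
  apply: le_trans (_ : \sum_(C in live S) (1 - K%:R * (1 - eta / 8) * x C) <= _).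
    apply: ler_sum => C CS; apply: (le_trans (bernoulli_le _ (x01 C))).
    have /andP[xC _] := x01 C; rewrite mulrAC.
    by apply: binomial_step (kap _ CS); rewrite mulr_ge0.
  by rewrite sumrB sumr_const -mulr_sumr.
apply: (le_trans hx).
apply: le_trans (_ : D * (1 - T%:R * y) <= _); last first.
  by rewrite ler_wpM2l ?(ltW D0) // bernoulli_ge.
have TK : T%:R = K%:R * (1 + eta / 4).
  have -> : T = (K + M)%N by rewrite /T /K mulSn addnC.
  have -> : K%:R * (1 + eta / 4) = K%:R + 16 * (F * eta) * M%:R :> R.
    by rewrite /K !natrM -/F exponent_split.
  by rewrite Feta natrD; congr (_ + _); rewrite divff ?mul1r // pnatr_eq0.
rewrite [D * (1 - _)]mulrBr mulr1 lerD2l lerN2 mulrCA [D * y]mulrCA mulrA TK -!mulrA ler_wpM2l //.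
rewrite /sx -mulr_suml -natr_sum [F * (D / E)]mulrA.
have h := sum_meeting S; rewrite -(ler_nat R) !natrD [X in _ + X + _]natrM -/D -/F in h.
have := cauchy_sum R (mem S) (deg S); rewrite sum_deg natrM -/F -/D -/E => hc.
exact: drift_bound hc h.
Qed.

Variable Q : pred nat.

(** The random greedy matching: the same recursion as [removal_prob_rec], with the
    set of uncovered vertices as the state. *)
Fixpoint greedy_prob (n : nat) (S : {set X}) : R :=
  if live S == set0 then (Q #|S|)%:R
  else if n is n'.+1 then
    (\sum_(C in live S) greedy_prob n' (S :\: C)) / #|live S|%:R
  else 0.

Lemma greedy_prob_ge0 n S : 0 <= greedy_prob n S.
Proof.
elim: n S => [|n IH] S /=; case: ifP => // _.
by rewrite divr_ge0 // sumr_ge0.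
Qed.

Variable s0 : nat.
Hypothesis Qs0 : forall r, (s0 <= r)%N -> Q r.

Lemma live0_small (S C : {set X}) n :
  (#|S| <= n.+1)%N -> C \in live S -> (#|S :\: C| <= n)%N.
Proof. by move=> Sn CS; have := card_setD_live CS; lia. Qed.

(** Dead vertices stay dead, so that [s0] of them decide the outcome. *)
Lemma greedy_prob_dead n (S : {set X}) :
  (#|S| <= n)%N -> (s0 <= #|dead S|)%N -> greedy_prob n S = 1.
Proof.
elim: n S => [|n IH] S Sn hd /=; case: (altP (live S =P set0)) => [L0|/set0Pn[C CS]].
- by rewrite Qs0 // -(dead_terminal L0).
- by have := card_setD_live CS; lia.
- by rewrite Qs0 // -(dead_terminal L0).
rewrite (eq_bigr (fun=> 1)) => [|D DS].
  rewrite sumr_const divff // pnatr_eq0 -lt0n card_gt0.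
  by apply/set0Pn; exists C.
by rewrite IH ?(live0_small Sn) // (leq_trans hd) // subset_leq_card // sub_dead.
Qed.

Variables (E0 : R) (j0 : nat).
Hypothesis E0f : 2 * f%:R <= E0.
Hypothesis E0s : 32 * f%:R * s0%:R <= E0.
Hypothesis E0j : 8 * f%:R * j0%:R <= E0.
Hypothesis E0beta : 32 * f%:R ^+ 3 * Dl%:R * beta%:R <= E0.
Hypothesis E0M : 8192 * f%:R ^+ 4 * M%:R * Dl%:R <= E0.

(** The first term exceeds 1 in states with at least [j0] lone hyperedges and
    fewer than [s0] dead vertices, the second one in states with about [E0]
    vertices and an average degree of at least 1.  Between them these two kinds of
    states stop every run that has not yet succeeded. *)
Definition pot (S : {set X}) : R :=
  2 ^+ s0 * (1 - lone_rate) ^+ j0 * lonepot S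
  + (f%:R ^+ (64 * f) * E0) ^+ M * degpot S.

Lemma lonepot_ge0 S : 0 <= lonepot S.
Proof. by rewrite mulr_ge0 // exprn_ge0 ?invr_ge0 // subr_ge0 ltW // lone_rate_lt1. Qed.

Lemma degpot_ge0 S : 0 <= degpot S.
Proof. by rewrite divr_ge0 // exprn_ge0. Qed.

Lemma E0_gt0 : 0 < E0.
Proof. by apply: lt_le_trans E0f; rewrite mulr_gt0 // ltr0n (leq_trans _ f3). Qed.

Let c1_ge0 : 0 <= 2 ^+ s0 * (1 - lone_rate) ^+ j0 :> R.
Proof. by rewrite mulr_ge0 ?exprn_ge0 // subr_ge0 ltW // lone_rate_lt1. Qed.

Let c2_ge0 : 0 <= (f%:R ^+ (64 * f) * E0) ^+ M :> R.
Proof. by rewrite exprn_ge0 // mulr_ge0 ?exprn_ge0 // ltW // E0_gt0. Qed.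

(** The average degree is close to 1: then there are [j0] lone hyperedges. *)
Lemma pot_sparse (S : {set X}) (eta := (16 * f%:R)^-1 : R) :
  E0 - f%:R <= #|S|%:R -> (#|dead S| < s0)%N ->
  f%:R * #|live S|%:R < (1 + eta) * #|S|%:R ->
  1 <= pot S.
Proof.
move=> ES dS dense.
set F : R := f%:R in ES dense *; set E : R := #|S|%:R in ES dense *.
have F3 : 3 <= F by rewrite ler_nat.
have etaF : F * eta = 16^-1 by rewrite /eta -/F; field; rewrite gt_eqF // (lt_le_trans _ F3).
have E2 : E0 <= 2 * E by apply: double_bound ES.
have F0 : 0 < F by apply: lt_le_trans F3.
have jS : (j0 <= #|alone S|)%N.
  rewrite -(ler_nat R).
  have h1 := card_live_lone S; rewrite -(ler_nat R) 2!natrD !natrM natrD natrM in h1.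
  have h2 := card_alone S; rewrite -(ler_nat R) natrD in h2.
  apply: (lone_bound F3 etaF _ h1 h2) dense => //.
  - apply: le_trans (_ : s0%:R <= _); first by rewrite ler_nat ltnW.
    rewrite -(ler_pM2l (_ : 0 < 32 * F)) ?mulr_gt0 //; apply: le_trans E0s _.
    by rewrite mulrA -[32 * F * eta]mulrA etaF (_ : 32 / 16 = 2) //; field.
  - have : (#|S| <= #|dead S| + f * #|live S|)%N.
      rewrite -sum_deg -(cardsID (dead S) S) leq_add //.
        by apply/subset_leq_card/subsetP => e; rewrite in_setI => /andP[].
      rewrite -sum1_card [X in (_ <= X)%N](big_setID (dead S)) /=.
      rewrite (leq_trans _ (leq_addl _ _)) //; apply: leq_sum => e.
      by rewrite in_setD in_set => /andP[+ eS]; rewrite eS /= lt0n.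
    by rewrite -(ler_nat R) natrD natrM -/F -/E lerBlDl.
  - rewrite ler_pdivlMr // -(ler_pM2l (_ : 0 < 2)) //; apply: le_trans E2.
    apply: le_trans E0beta; rewrite -/F.
    have h : 1 <= F ^+ 2 * Dl%:R.
      have F1 : 1 <= F by apply: le_trans F3; rewrite ler1n.
      by rewrite mulr_ege1 ?exprn_ege1 // ler1n.
    have -> : 2 * (beta%:R * F * 16) = 32 * F * beta%:R * 1 by ring.
    have -> : 32 * F ^+ 3 * Dl%:R * beta%:R = 32 * F * beta%:R * (F ^+ 2 * Dl%:R) by ring.
    by rewrite ler_wpM2l // !mulr_ge0 // ltW.
  - by apply: le_trans E0j E2.
apply: (@le_trans _ _ (2 ^+ s0 * (1 - lone_rate) ^+ j0 * lonepot S)); last first.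
  by rewrite lerDl mulr_ge0 ?degpot_ge0.
have b1 : 0 < 1 - lone_rate by rewrite subr_gt0 lone_rate_lt1.
apply: (@le_trans _ _ ((2 ^+ s0 * (1 - lone_rate) ^+ j0) * ((2^-1) ^+ s0 * ((1 - lone_rate)^-1) ^+ j0))).
  by rewrite mulrACA -!exprMn !divff ?expr1n ?mulr1 // gt_eqF.
rewrite ler_wpM2l //; apply: ler_pM; rewrite ?exprn_ge0 ?invr_ge0 ?(ltW b1) //.
  by apply: ler_wiXn2l (ltnW dS); rewrite ?invr_ge0 ?invf_le1 ?ler1n.
apply: ler_weXn2l => //; rewrite invf_ge1 //.
by rewrite gerBl ltW // lone_rate_gt0.
Qed.

(** The average degree is still above 1 when only [E0] vertices are left. *)
Lemma pot_dense (S : {set X}) :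
  E0 - f%:R <= #|S|%:R -> #|S|%:R < E0 ->
  #|S|%:R <= f%:R * #|live S|%:R :> R -> 1 <= pot S.
Proof.
move=> ES SE dense; apply: (@le_trans _ _ ((f%:R ^+ (64 * f) * E0) ^+ M * degpot S)); last first.
  by rewrite lerDr mulr_ge0 ?lonepot_ge0.
have F0 : 0 < f%:R :> R by rewrite ltr0n (leq_trans _ f3).
have E1 : 0 < #|S|%:R :> R by have := lt_le_trans E0_gt0 (double_bound E0f ES); rewrite pmulr_rgt0.
rewrite /degpot; set q := (64 * f)%N; rewrite (exprM _ q M) (exprM _ q.+1 M) -expr_div_n -exprMn exprn_ege1 //.
rewrite mulrA ler_pdivlMr ?exprn_gt0 // mul1r exprS mulrAC -exprMn [X in _ <= X]mulrC.
rewrite ler_pM ?exprn_ge0 //; first exact: ltW.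
by apply: lerXn2r; rewrite ?nnegrE ?mulr_ge0.
Qed.

(** Induction along the process up to the first state in which [s0] vertices are
    dead, or the average degree is below 1 + 1 / (16 f), or fewer than [E0]
    vertices are left.  Before, both terms of [pot] are supermartingales.  One step
    removes f vertices, whence the slack f in the hypothesis on [S]. *)
Lemma greedy_fail_le n (S : {set X}) : (#|S| <= n)%N -> E0 - f%:R <= #|S|%:R ->
  1 - greedy_prob n S <= pot S.
Proof.
elim: n S => [|n IH] S Sn ES.
  have : #|S|%:R = 0 :> R by move: Sn; rewrite leqn0 => /eqP->.
  have := lt_le_trans E0_gt0 (double_bound E0f ES).
  by rewrite pmulr_rgt0 // => /gt_eqF/eqP.
have pS : 0 <= pot S by rewrite addr_ge0 // mulr_ge0 ?lonepot_ge0 ?degpot_ge0.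
have trivial_case : 1 <= pot S -> 1 - greedy_prob n.+1 S <= pot S.
  by move=> h; rewrite (le_trans _ h) // gerBl greedy_prob_ge0.
have [hd|hd] := leqP s0 #|dead S|.
  by rewrite greedy_prob_dead // subrr.
have [hl|] := boolP (f%:R * #|live S|%:R < (1 + (16 * f%:R)^-1) * #|S|%:R :> R).
  exact/trivial_case/(pot_sparse ES hd hl).
rewrite -leNgt => hl.
have F3 : 3 <= f%:R :> R by rewrite ler_nat.
have dense : #|S|%:R <= f%:R * #|live S|%:R :> R.
  by apply: le_trans hl; rewrite ler_peMl // lerDl invr_ge0 mulr_ge0.
have [hE|] := boolP (#|S|%:R < E0).
  exact/trivial_case/pot_dense.
rewrite -leNgt => hE.
have E0D : E0 <= f%:R * #|live S|%:R by apply: le_trans dense.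
have D0 : 0 < #|live S|%:R :> R.
  have : 0 < f%:R * #|live S|%:R :> R by exact: lt_le_trans E0_gt0 E0D.
  by rewrite pmulr_rgt0 // (lt_le_trans _ F3).
have L0 : live S == set0 = false.
  by apply/negbTE; rewrite -card_gt0 -(ltr_nat R).
rewrite /= L0.
rewrite -[X in X - _](divff (lt0r_neq0 D0)) -mulrBl ler_pdivrMr //.
have -> : #|live S|%:R - \sum_(C in live S) greedy_prob n (S :\: C)
    = \sum_(C in live S) (1 - greedy_prob n (S :\: C)).
  by rewrite sumrB sumr_const.
apply: le_trans (_ : \sum_(C in live S) pot (S :\: C) <= _).
  apply: ler_sum => C CS; apply: IH; first exact: live0_small Sn CS.
  have := card_setD_live CS => /(congr1 (fun x => x%:R : R)); rewrite natrD.
  by move=> Sf; rewrite lerBlDr Sf.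
rewrite big_split /= -!mulr_sumr mulrDl lerD //.
  by rewrite -[X in _ <= X]mulrA ler_wpM2l // [X in _ <= X]mulrC lonepot_drift.
rewrite -[X in _ <= X]mulrA ler_wpM2l // [X in _ <= X]mulrC.
have F0 : 0 < f%:R :> R by apply: lt_le_trans F3.
apply: degpot_drift => //.
- rewrite -(ltr_nat R); apply: lt_le_trans hE; apply: lt_le_trans E0f.
  by rewrite mulrC ltr_pMr ?ltr1n.
- rewrite !natrM -(ler_pM2l (_ : 0 < 32 * f%:R ^+ 2)) ?mulr_gt0 ?exprn_gt0 //.
  apply: le_trans (_ : f%:R * #|live S|%:R <= _).
    apply: le_trans E0D; apply: le_trans E0beta.
    by rewrite le_eqVlt; apply/orP; left; apply/eqP; ring.
  by rewrite le_eqVlt; apply/orP; left; apply/eqP; field; rewrite gt_eqF.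
- rewrite !natrM -(ler_pM2l (_ : 0 < 128 * f%:R ^+ 2)) ?mulr_gt0 ?exprn_gt0 //.
  apply: le_trans (_ : f%:R * #|live S|%:R <= _).
    apply: le_trans E0D; apply: le_trans E0M.
    by rewrite le_eqVlt; apply/orP; left; apply/eqP; ring.
  by rewrite le_eqVlt; apply/orP; left; apply/eqP; field; rewrite gt_eqF.
Qed.

(** At the start no vertex is dead and no hyperedge is lone, because all degrees
    are at least 2, and the average degree is at most [Dl]. *)
Lemma greedy_fail (S : {set X}) :
  (forall e, e \in S -> (2 <= deg S e)%N) -> E0 <= #|S|%:R ->
  1 - greedy_prob #|S| S <=
    2 ^+ s0 * (1 - lone_rate) ^+ j0 + (Dl%:R ^+ (64 * f) * E0 / #|S|%:R) ^+ M.
Proof.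
move=> degS ES.
have S0 : 0 < #|S|%:R :> R by apply: lt_le_trans ES; apply: E0_gt0.
apply: le_trans (greedy_fail_le (leqnn _) _) _.
  by rewrite (le_trans _ ES) // gerBl.
have d0 : dead S = set0.
  apply/setP=> e; rewrite in_set0 in_set; apply/negP=> /andP[eS].
  by have := degS _ eS; case: (deg S e).
have l0 : lone S = set0.
  apply/setP=> C; rewrite in_set0 in_set; apply/negP=> /andP[CS /forall_inP h].
  have [CC sCS] : C \in cc /\ C \subset S by move: CS; rewrite in_live => /andP[].
  have /set0Pn[e eC] : C != set0 by rewrite -card_gt0 unif // (leq_trans _ f3).
  have := degS e (subsetP sCS _ eC); rewrite /deg (cardsD1 C) in_set CS eC ltnS card_gt0.
  case/set0Pn => D; rewrite in_setD1 in_set => /andP[DC /andP[DS eD]].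
  by have /disjointFr/(_ eD) := implyP (h _ DS) DC; rewrite eC.
rewrite /pot lerD //.
  by rewrite /lonepot d0 /alone l0 set0D !cards0 !expr0 !mulr1.
have F0 : 0 < f%:R :> R by rewrite ltr0n (leq_trans _ f3).
rewrite /degpot; set q := (64 * f)%N; rewrite (exprM _ q M) (exprM _ q.+1 M) -expr_div_n -exprMn.
have E0' := ltW E0_gt0.
apply: lerXn2r; rewrite ?nnegrE ?mulr_ge0 ?invr_ge0 ?exprn_ge0 //.
rewrite mulrA ler_pdivrMr ?exprn_gt0 // exprS mulrA divfK ?gt_eqF //.
rewrite mulrAC -exprMn [X in _ <= X]mulrAC -exprMn ler_wpM2r //.
apply: lerXn2r; rewrite ?nnegrE ?mulr_ge0 // -!natrM ler_nat -sum_deg mulnC -sum_nat_const.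
exact: leq_sum.
Qed.

End GreedyMatching.

(** * Weights of edge sets, and the light sets in cycles of copies *)

Lemma int_lt (x y d w : int) : x + y <= d + w -> d <= w -> w < y -> x < w.
Proof. lia. Qed.

Lemma int_le (x y d w : int) : x + y <= d + w -> d <= w -> w <= y -> x <= w.
Proof. lia. Qed.

(** The counting in [cycle_light]: a set of size [f] is covered by two pieces of
    sizes [x] and [bc], the first of which is the union of pieces of sizes [bp] and
    [ba] with [y] common elements. *)
Lemma three_blocks (f x y bp ba bc : nat) : (2 < f)%N -> (f <= x + bc)%N ->
  (x + y <= bp + ba)%N -> (bp <= 1)%N -> (bc <= 1)%N ->
  (0 < ba)%N /\ ((ba <= 1)%N -> f = 3 /\ y = 0%N).
Proof. lia. Qed.

Section Weight.
Variables (U : finType) (a b : nat).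

(** For a = f - 1 and b = m - k, the expected number of copies of a template with
    edge set [B] and empty root in a random k-graph of density n^(-b/a) is n to
    the power [wt B / a]. *)
Definition wt (B : {set {set U}}) : int :=
  (a * #|cover B|)%N%:Z - (b * #|B|)%N%:Z.

Lemma coverU (B C : {set {set U}}) : cover (B :|: C) = cover B :|: cover C.
Proof. by rewrite /cover bigcup_setU. Qed.

Lemma coverS (B C : {set {set U}}) : B \subset C -> cover B \subset cover C.
Proof.
move=> /subsetP BC; apply/bigcupsP => e eB; exact: (bigcup_max e) (BC _ eB) _.
Qed.

Lemma wt_submod (B C : {set {set U}}) : wt (B :|: C) + wt (B :&: C) <= wt B + wt C.
Proof.
rewrite /wt coverU; have h1 := cardsUI B C; have h2 := cardsUI (cover B) (cover C).
have h3 : (#|cover (B :&: C)| <= #|cover B :&: cover C|)%N.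
  by apply/subset_leq_card; rewrite subsetI !coverS ?subsetIl ?subsetIr.
have := leq_mul (leqnn a) h3.
have := congr1 (muln a) h2; have := congr1 (muln b) h1; rewrite !mulnDr; lia.
Qed.

Variables (f : nat) (w0 : int) (cc : {set {set {set U}}}).
Hypothesis f3 : (2 < f)%N.
Hypothesis unif : forall C, C \in cc -> #|C| = f.
Hypothesis wtC : forall C, C \in cc -> wt C = w0.
Hypothesis wt2 : forall B C : {set {set U}}, C \in cc -> B \subset C -> (2 <= #|B| < f)%N -> w0 < wt B.

(** Submodularity: the two copies have weight [w0], their intersection more. *)
Lemma overlap_light (C D : {set {set U}}) : C \in cc -> D \in cc -> D != C ->
  (2 <= #|C :&: D|)%N -> wt (C :|: D) < w0.
Proof.
move=> CC DC DneC CD; have := wt_submod C D; rewrite (wtC CC) (wtC DC).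
have : (#|C :&: D| < f)%N.
  rewrite -(unif CC); apply: proper_card; rewrite properEneq subsetIl andbT.
  apply: contra DneC => /eqP/setIidPl CsD; rewrite eq_sym eqEcard CsD.
  by rewrite (unif CC) (unif DC) leqnn.
move=> CDf h; apply: int_lt h (lexx _) (wt2 CC (subsetIl C D) _).
by rewrite CD CDf.
Qed.

(** If no subset of the union Z of the four copies is light, then gluing copies
    along nonempty intersections keeps the weight at most [w0] (glue), and a copy
    that meets such a union in two edges is contained in it (close).  So [B], which
    meets the disjoint sets [P] and [C], lies in the union of [P], [A] and [C].
    Distinct copies share at most one edge, so f = 3 and [B] takes its three edges
    from [P], [A] and [C].  Then [P] meets the union of [A] and [B] in exactly two
    edges, and should be contained in it: a contradiction. *)
Lemma cycle_light (P A B C : {set {set U}}) :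
  P \in cc -> A \in cc -> B \in cc -> C \in cc -> A != B ->
  [disjoint P & C] ->
  ~~ [disjoint A & P] -> ~~ [disjoint B & P] ->
  ~~ [disjoint A & C] -> ~~ [disjoint B & C] ->
  exists2 Y : {set {set U}}, Y \subset P :|: A :|: B :|: C & Y != set0 /\ wt Y < w0.
Proof.
move=> PC AC BC CC AB dPC mAP mBP mAC mBC.
set Z := P :|: A :|: B :|: C.
have [|noY] := pselect (exists2 Y : {set {set U}}, Y \subset Z & Y != set0 /\ wt Y < w0); first by [].
exfalso; have free (Y : {set {set U}}) : Y \subset Z -> Y != set0 -> w0 <= wt Y.
  by move=> YZ Y0; rewrite leNgt; apply/negP => h; apply: noY; exists Y.
have sP : P \subset Z by rewrite /Z -!setUA subsetUl.
have sA : A \subset Z by rewrite /Z [P :|: A]setUC -!setUA subsetUl.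
have sB : B \subset Z by rewrite /Z [_ :|: B]setUC -!setUA subsetUl.
have sC : C \subset Z by rewrite /Z subsetUr.
have ne (D E : {set {set U}}) : ~~ [disjoint D & E] -> D :&: E != set0 by rewrite -setI_eq0.
have neq (D E G : {set {set U}}) : [disjoint E & G] -> ~~ [disjoint D & G] -> D != E.
  by move=> h; apply: contraNneq => ->.
have lin (D E : {set {set U}}) : D \in cc -> E \in cc -> E != D -> D \subset Z -> E \subset Z ->
    (#|D :&: E| <= 1)%N.
  move=> DC EC ED sD sE; rewrite leqNgt; apply/negP => h.
  have := overlap_light DC EC ED h; rewrite ltNge free ?subUset ?sD //.
  by rewrite -card_gt0 (leq_trans _ (subset_leq_card (subsetUl D E))) // unif // (leq_trans _ f3).
have glue (D E : {set {set U}}) : D \subset Z -> E \in cc -> E \subset Z -> wt D <= w0 ->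
    ~~ [disjoint D & E] -> wt (D :|: E) <= w0.
  move=> sD EC sE wD mDE; have := wt_submod D E; rewrite (wtC EC).
  move=> h; apply: int_le h wD (free _ _ (ne _ _ mDE)).
  exact: subset_trans (subsetIl _ _) sD.
have close (D E : {set {set U}}) : D \subset Z -> E \in cc -> E \subset Z -> wt D <= w0 ->
    (2 <= #|E :&: D|)%N -> E \subset D.
  move=> sD EC sE wD c2; apply/negPn/negP => nED.
  have : (#|E :&: D| < f)%N.
    rewrite -(unif EC); apply: proper_card; rewrite properEneq subsetIl andbT.
    by apply: contra nED => /eqP/setIidPl.
  move=> cf; have := wt_submod D E; rewrite (wtC EC) setIC => h.
  have : wt (D :|: E) < w0.
    by apply: int_lt h wD (wt2 EC (subsetIl E D) _); rewrite c2 cf.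
  rewrite ltNge free ?subUset ?sD //.
  by rewrite -card_gt0 (leq_trans _ (subset_leq_card (subsetUr D E))) // unif // (leq_trans _ f3).
have BP : B != P by apply: neq dPC mBC.
have AP : A != P by apply: neq dPC mAC.
have BCn : B != C by apply: neq mBP; rewrite disjoint_sym.
have c1 : (0 < #|B :&: P|)%N by rewrite card_gt0 ne.
have c2 : (0 < #|B :&: C|)%N by rewrite card_gt0 ne.
have wPA : wt (P :|: A) <= w0 by apply: glue; rewrite ?wtC // disjoint_sym.
have wY : wt (P :|: A :|: C) <= w0.
  apply: glue => //; first by rewrite subUset sP.
  by apply: contra mAC; apply: disjointWl; apply: subsetUr.
have two (D E G : {set {set U}}) : [disjoint E & G] -> (#|D :&: E| + #|D :&: G| <= #|D :&: (E :|: G)|)%N.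
  move=> dEG; rewrite setIUr cardsU.
  have -> : D :&: E :&: (D :&: G) = set0.
    by apply/eqP; rewrite -subset0 -(eqP (_ : E :&: G == set0)) ?setI_eq0 // setISS ?subsetIr.
  by rewrite cards0 subn0.
have BY : B \subset P :|: A :|: C.
  apply: close => //; first by rewrite !subUset sP sA.
  have := two B P C dPC.
  have : (#|B :&: (P :|: C)| <= #|B :&: (P :|: A :|: C)|)%N.
    by apply/subset_leq_card/setIS; rewrite setUAC subsetUl.
  by move=> h1 h2; apply: leq_trans (leq_trans (leq_add c1 c2) h2) h1.
have lBP := lin _ _ BC PC (_ : P != B) sB sP; rewrite eq_sym BP in lBP.
have lBC := lin _ _ BC CC (_ : C != B) sB sC; rewrite eq_sym BCn in lBC.
have lBA := lin _ _ BC AC AB sB sA.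
have lPA := lin _ _ PC AC AP sP sA.
have lPB := lin _ _ PC BC BP sP sB.
have cB : (#|B| <= #|B :&: (P :|: A)| + #|B :&: C|)%N.
  by have [+ _] := leq_card_setU (B :&: (P :|: A)) (B :&: C); rewrite -setIUr (setIidPl BY).
have cPA : (#|B :&: (P :|: A)| + #|B :&: P :&: A| <= #|B :&: P| + #|B :&: A|)%N.
  rewrite setIUr -(cardsUI (B :&: P)) leq_add2l.
  by apply/subset_leq_card; rewrite subsetI subsetIl -setIA setIS // subsetIr.
rewrite (unif BC) in cB; have [ba0 ba1] := three_blocks f3 cB cPA (lBP isT) (lBC isT).
have [fe PAB0] := ba1 lBA.
have BA0 : ~~ [disjoint B & A] by rewrite -setI_eq0 -card_gt0.
have wAB : wt (A :|: B) <= w0 by apply: glue; rewrite ?wtC // disjoint_sym.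
have e1 : #|P :&: A :&: (P :&: B)| = 0%N.
  rewrite -PAB0; congr #|pred_of_set _|; apply/setP => x; rewrite !inE.
  by case: (x \in P); case: (x \in A); case: (x \in B).
have e2 : (#|P :&: (A :|: B)| = #|P :&: A| + #|P :&: B|)%N.
  by rewrite setIUr -cardsUI e1 addn0.
have p1 : (0 < #|P :&: A|)%N by rewrite card_gt0 ne // disjoint_sym.
have p2 : (0 < #|P :&: B|)%N by rewrite card_gt0 ne // disjoint_sym.
have PAB : P \subset A :|: B.
  by apply: close; rewrite ?subUset ?sA ?sB // e2 (leq_add p1 p2).
by have := leq_add lPA lPB; rewrite -e2 (setIidPl PAB) (unif PC) fe.
Qed.
End Weight.

(** * Copies of a strictly balanced k-graph as hyperedges *)

Section Images.
Variables (T U : finType) (A : {set T}) (g : {x | x \in A} -> U).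

Lemma imgE (e : {set T}) : img g e = g @: [set x | val x \in e].
Proof. by apply: eq_in_imset. Qed.

Lemma card_pre (e : {set T}) : e \subset A -> #|[set x : {x | x \in A} | val x \in e]| = #|e|.
Proof.
move=> /subsetP eA; rewrite -(card_imset _ val_inj); apply: eq_card => x.
apply/imsetP/idP => [[y + ->]|xe]; first by rewrite inE.
by exists (exist _ x (eA _ xe)); rewrite ?inE.
Qed.

Lemma img_cover (B : {set {set T}}) : cover [set img g e | e in B] = img g (cover B).
Proof.
apply/setP => y; rewrite imgE; apply/bigcupP/imsetP.
  case=> _ /imsetP[e eB ->]; rewrite imgE => /imsetP[x]; rewrite inE => xe ->.
  by exists x; rewrite // inE; apply/bigcupP; exists e.
case=> x; rewrite inE => /bigcupP[e eB xe] ->.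
exists (img g e); first exact: imset_f.
by rewrite imgE imset_f // inE.
Qed.

Hypothesis gI : injective g.

Lemma card_img (e : {set T}) : e \subset A -> #|img g e| = #|e|.
Proof. by move=> eA; rewrite imgE card_imset // card_pre. Qed.

Lemma img_inj (e1 e2 : {set T}) : e1 \subset A -> e2 \subset A ->
  img g e1 = img g e2 -> e1 = e2.
Proof.
suff sub (e e' : {set T}) : e \subset A -> img g e = img g e' -> e \subset e'.
  move=> h1 h2 h; apply/eqP; rewrite eqEsubset (sub _ _ h1 h).
  by rewrite (sub _ _ h2 (esym h)).
move=> /subsetP eA h; apply/subsetP => x xe.
have : g (exist _ x (eA _ xe)) \in img g e by rewrite imgE imset_f // inE.
by rewrite h imgE => /imsetP[y]; rewrite inE => ye /gI yE; rewrite -yE in ye.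
Qed.

Lemma card_img_set (B : {set {set T}}) : (forall e, e \in B -> e \subset A) ->
  #|[set img g e | e in B]| = #|B|.
Proof.
by move=> BA; apply: card_in_imset => e1 e2 /BA h1 /BA h2; apply: img_inj.
Qed.

Lemma wt_img (a b : nat) (B : {set {set T}}) : (forall e, e \in B -> e \subset A) ->
  wt a b [set img g e | e in B] = wt a b B.
Proof.
move=> BA; rewrite /wt img_cover card_img_set // card_img //.
by apply/bigcupsP => e /BA.
Qed.
End Images.

Lemma wt_arith (a b c k n : nat) : (0 < n)%N -> (k <= c)%N ->
  (n.-1 * b < a * (c - k))%N ->
  (a * k)%N%:Z - b%:Z < (a * c)%N%:Z - (b * n)%N%:Z.
Proof.
case: n => // n _ kc; rewrite mulnBr mulnS mulnC /=.
by have := leq_mul (leqnn a) kc; lia.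
Qed.

Section KGraphs.
Variables (k : nat) (T : finType).

Lemma edge_sub (G : kgraph k T) e : e \in eset G -> e \subset vset G.
Proof. by move=> eG; have /andP[] := forall_inP (kgraph_valP G) e eG. Qed.

Lemma edge_card (G : kgraph k T) e : e \in eset G -> #|e| = k.
Proof. by move=> eG; have /andP[_ /eqP] := forall_inP (kgraph_valP G) e eG. Qed.

Lemma kgraph_eq (G H : kgraph k T) : vset G = vset H -> eset G = eset H -> G = H.
Proof.
move=> hv he; apply: val_inj => /=; move: hv he; rewrite /vset /eset.
by case: (kgraph_val G) => ? ?; case: (kgraph_val H) => ? ? /= -> ->.
Qed.

Lemma cover_edges_sub (G : kgraph k T) : cover (eset G) \subset vset G.
Proof. by apply/bigcupsP => e; apply: edge_sub. Qed.

End KGraphs.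

Section StrictlyBalanced.
Variables (k : nat) (T : finType) (F : kgraph k T).
Hypothesis hk : (2 <= k)%N.

Lemma spanned_subproof (B : {set {set T}}) :
  B \subset eset F -> is_kgraph k (cover B, B).
Proof.
move=> /subsetP BF; apply/forall_inP => e /= eB.
by rewrite (edge_card (BF _ eB)) eqxx andbT (bigcup_max e).
Qed.

Lemma cover_gt (B : {set {set T}}) : B \subset eset F -> (2 <= #|B|)%N ->
  (k < #|cover B|)%N.
Proof.
move=> BF /card_gt1P[e1 [e2 [e1B e2B e12]]].
have e1c : e1 \subset cover B by apply: (bigcup_max e1).
have e2c : e2 \subset cover B by apply: (bigcup_max e2).
rewrite -(edge_card (subsetP BF _ e1B)); apply: proper_card.
rewrite properEneq e1c andbT; apply: contra e12 => /eqP E.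
rewrite -E in e2c; rewrite eq_sym eqEcard e2c.
by rewrite (edge_card (subsetP BF _ e1B)) (edge_card (subsetP BF _ e2B)) leqnn.
Qed.

Hypothesis hF : strictly_kbalanced F.

Lemma ne_ge3 : (2 < ne F)%N. Proof. by case: hF. Qed.

Lemma density_lt (a b c d : nat) : (0 < b)%N -> (0 < d)%N ->
  (a%:R / b%:R < c%:R / d%:R :> rat) = (a * d < c * b)%N.
Proof.
move=> b0 d0; rewrite ltr_pdivrMr ?ltr0n // mulrAC ltr_pdivlMr ?ltr0n //.
by rewrite -!natrM ltr_nat.
Qed.

Lemma kdensityE (G : kgraph k T) : (0 < ne G)%N -> (k <= nv G)%N ->
  kdensity G = (ne G).-1%:R / (nv G - k)%:R.
Proof. by move=> h1 h2; rewrite /kdensity -subn1 !natrB. Qed.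

(** Strict k-balancedness without division, for the subgraph spanned by [B]. *)
Lemma spanned_density (B : {set {set T}}) : B \subset eset F -> (2 <= #|B|)%N ->
  (cover B, B) != (vset F, eset F) ->
  (#|B|.-1 * (nv F - k) < (ne F).-1 * (#|cover B| - k))%N.
Proof.
move=> BF B2 BneF; have cB := cover_gt BF B2.
have vF : (#|cover B| <= nv F)%N.
  by apply/subset_leq_card/(subset_trans (coverS BF))/cover_edges_sub.
pose G := KGraph (spanned_subproof BF).
have : kdensity G < kdensity F.
  apply: (hF.2 G) => //.
  by rewrite /subgraph /= /eset /vset /= BF (subset_trans (coverS BF)) ?cover_edges_sub.
have kF := leq_trans (ltnW cB) vF.
rewrite (@kdensityE G (ltnW B2) (ltnW cB)) (kdensityE (ltnW (ltnW ne_ge3)) kF).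
by rewrite density_lt // subn_gt0 // (leq_trans cB).
Qed.

(** An isolated vertex could be deleted without lowering the density.  So a copy
    of F is determined by its edges. *)
Lemma cover_edges : cover (eset F) = vset F.
Proof.
apply/eqP; rewrite eqEcard cover_edges_sub /= leqNgt; apply/negP => lt.
have := spanned_density (subxx _) (ltnW ne_ge3) _.
have -> : (cover (eset F), eset F) != (vset F, eset F).
  by rewrite xpair_eqE negb_and; apply/orP; left; apply: contraTneq lt => ->; rewrite ltnn.
move=> /(_ isT); rewrite -/(ne F) ltn_mul2l => /andP[_]; rewrite ltnNge leq_sub2r //.
exact: ltnW.
Qed.

Lemma nv_gt : (k < nv F)%N.
Proof. by rewrite /nv -cover_edges; apply: cover_gt; rewrite // ltnW // ne_ge3. Qed.

Definition w0 : int := ((ne F).-1 * k)%N%:Z - (nv F - k)%N%:Z.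

Notation fwt := (wt (ne F).-1 (nv F - k)).

Lemma wt_full : fwt (eset F) = w0.
Proof.
rewrite /wt cover_edges /w0 -/(ne F) -/(nv F); have := ne_ge3; have := nv_gt.
move: (ne F) (nv F) => f m km f3.
have -> : m = ((m - k) + k)%N by lia.
by rewrite addnK; move: (m - k)%N => b; case: f f3 => // f _ /=; lia.
Qed.

Lemma wt_sub (B : {set {set T}}) : B \subset eset F -> (2 <= #|B| < ne F)%N ->
  w0 < fwt B.
Proof.
move=> BF /andP[B2 Bf]; have := spanned_density BF B2; have := cover_gt BF B2.
have -> : (cover B, B) != (vset F, eset F).
  rewrite xpair_eqE negb_and; apply/orP; right.
  by apply: contraTneq Bf => ->; rewrite ltnn.
by move=> kc h; apply: wt_arith (ltnW B2) (ltnW kc) (h isT).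
Qed.

(** This says 1 / rho < k - 1, so that H has more than n edges.  Two disjoint edges
    have density 1 / k; if all edges were disjoint, this would be rho.  So two
    edges meet, and they have density at least 1 / (k - 1). *)
Lemma nv_lt : (nv F - k < (ne F).-1 * k.-1)%N.
Proof.
have f3 := ne_ge3; have km := nv_gt.
have key e1 e2 : e1 \in eset F -> e2 \in eset F -> e1 != e2 ->
   (nv F - k < (ne F).-1 * (k - #|e1 :&: e2|))%N.
  move=> e1F e2F e12.
  have sub : [set e1; e2] \subset eset F by apply/subsetP => e; rewrite !inE => /orP[]/eqP->.
  have := wt_sub sub; rewrite cards2 e12 => /(_ f3); rewrite /wt cards2 e12 /w0.
  have -> : cover [set e1; e2] = e1 :|: e2 by rewrite /cover bigcup_setU !big_set1.
  rewrite cardsU (edge_card e1F) (edge_card e2F).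
  have : (#|e1 :&: e2| <= k)%N.
    by rewrite -(edge_card e1F); apply/subset_leq_card/subsetIl.
  move: #|_ :&: _| => i ik; rewrite -addnBA // mulnDr; lia.
have [tr|ntr] := boolP (trivIset (eset F)).
  exfalso; have := eqP tr; rewrite cover_edges -/(nv F).
  rewrite (eq_bigr (fun=> k)); last by move=> e; apply: edge_card.
  rewrite sum_nat_const -/(ne F) => mE.
  have /card_gt1P[e1 [e2 [e1F e2F e12]]] : (1 < #|eset F|)%N by apply: ltnW.
  have := key _ _ e1F e2F e12; rewrite -mE.
  have := leq_mul (leqnn (ne F).-1) (leq_subr #|e1 :&: e2| k).
  by case: (ne F) f3 => //= f _; rewrite mulSn; lia.
have [e1 [e2 [e1F e2F e12 mt]]] : exists e1 e2, [/\ e1 \in eset F, e2 \in eset F,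
    e1 != e2 & ~~ [disjoint e1 & e2]].
  apply: contrapT => h; move/negP: ntr; apply; apply/trivIsetP => e1 e2 e1F e2F e12.
  by apply/negPn/negP => mt; apply: h; exists e1, e2.
apply: leq_trans (key _ _ e1F e2F e12) _; rewrite leq_mul //.
by rewrite -setI_eq0 -card_gt0 in mt; lia.
Qed.

Section Copies.
Variables (U : finType) (H : kgraph k U).

Lemma copy_iso (C : kgraph k U) : C \in copies F H ->
  exists g : {ffun {x | x \in vset F} -> U},
    [/\ injective g, img g (vset F) = vset C & [set img g e | e in eset F] = eset C].
Proof.
rewrite in_set => /andP[_ /existsP[g /and3P[/injectiveP gI /eqP gV /eqP gE]]].
by exists g.
Qed.

Lemma copy_cover (C : kgraph k U) : C \in copies F H -> cover (eset C) = vset C.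
Proof. by case/copy_iso => g [_ gV gE]; rewrite -gE img_cover cover_edges. Qed.

Definition hyperedges := [set eset C | C in copies F H].

Lemma eset_inj : {in copies F H &, injective (@eset k U)}.
Proof.
by move=> C D CH DH E; apply: kgraph_eq => //; rewrite -!copy_cover // E.
Qed.

Lemma hyperedge_sub C : C \in hyperedges -> C \subset eset H.
Proof. by case/imsetP => G; rewrite in_set => /andP[/andP[_ GH] _] ->. Qed.

Lemma hyperedge_card C : C \in hyperedges -> #|C| = ne F.
Proof.
case/imsetP => G /copy_iso[g [gI _ gE]] ->; rewrite -gE card_img_set // => e.
exact: edge_sub.
Qed.

Lemma hyperedge_wt C : C \in hyperedges -> fwt C = w0.
Proof.
case/imsetP => G /copy_iso[g [gI _ gE]] ->; rewrite -gE wt_img ?wt_full // => e.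
exact: edge_sub.
Qed.

Lemma hyperedge_wt2 (B C : {set {set U}}) : C \in hyperedges -> B \subset C ->
  (2 <= #|B| < ne F)%N -> w0 < fwt B.
Proof.
case/imsetP => G /copy_iso[g [gI _ gE]] ->; rewrite -gE => BC.
pose B' := [set e in eset F | img g e \in B].
have B'F : B' \subset eset F by apply/subsetP => e; rewrite in_set => /andP[].
have BE : B = [set img g e | e in B'].
  apply/setP => e; apply/idP/imsetP => [eB|[e' + ->]]; last by rewrite in_set => /andP[].
  have /imsetP[e' e'F E] := subsetP BC _ eB.
  by exists e'; rewrite // in_set e'F -E.
have sB' e : e \in B' -> e \subset vset F by move/(subsetP B'F)/edge_sub.
by rewrite BE card_img_set // wt_img // => h; apply: wt_sub.
Qed.

Lemma hyperedge_cover C : C \in hyperedges -> #|cover C| = nv F.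
Proof.
case/imsetP => G /copy_iso[g [gI _ gE]] ->; rewrite -gE img_cover cover_edges.
by rewrite card_img.
Qed.

Lemma copies_sub (G : kgraph k U) : subgraph G H -> vset G = vset H ->
  copies F G = [set C in copies F H | eset C \subset eset G].
Proof.
move=> /andP[_ GH] vG; apply/setP => C; rewrite !in_set /subgraph vG.
case: (vset C \subset vset H) => //=; case: (isomorphic F C); rewrite ?andbF //= !andbT.
apply/idP/andP => [h|[]//]; split => //; exact: subset_trans GH.
Qed.

Lemma live_copies (G : kgraph k U) : subgraph G H -> vset G = vset H ->
  live hyperedges (eset G) = [set eset C | C in copies F G].
Proof.
move=> sG vG; rewrite copies_sub //; apply/setP => E; rewrite in_live.
apply/andP/imsetP => [[/imsetP[C CH ->] CG]|[C + ->]].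
  by exists C; rewrite // in_set CH.
by rewrite in_set => /andP[CH CG]; split=> //; apply: imset_f.
Qed.

(** Removing a copy keeps the vertex set, so that a state of the removal process is
    determined by its edge set. *)
Lemma removal_greedy (R : realType) (Q : pred nat) n (G : kgraph k U) :
  subgraph G H -> vset G = vset H ->
  removal_prob_rec R F Q n G = greedy_prob hyperedges R Q n (eset G).
Proof.
elim: n G => [|n IH] G sG vG /=; rewrite live_copies // imset_eq0 //.
case: ifP => // _.
have inj : {in copies F G &, injective (@eset k U)}.
  have sub C : C \in copies F G -> C \in copies F H.
    by rewrite copies_sub // in_set => /andP[].
  by move=> C D /sub CH /sub DH; apply: eset_inj.
rewrite card_in_imset // big_imset //=; congr (_ / _).
apply: eq_bigr => C CG; rewrite IH //.
move: sG; rewrite /subgraph /= => /andP[sv se]; rewrite sv.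
by rewrite (subset_trans (subsetDl _ _)).
Qed.
End Copies.
End StrictlyBalanced.

(** * The number of copies containing an edge *)

Section RootedCount.
Variables (k : nat) (T : finType) (F : kgraph k T).
Hypothesis hk : (2 <= k)%N.
Hypothesis hF : strictly_kbalanced F.

Lemma unroot_subproof (e : {set T}) : is_kgraph k (vset F, eset F :\ e).
Proof.
apply/forall_inP => e' /=; rewrite in_setD1 => /andP[_ e'F].
by rewrite edge_sub //= (edge_card e'F) eqxx.
Qed.

(** The edge [e] itself must go: [F] and [F] minus [e] have the same density over
    the root [e], so [F] is not a strictly balanced template over it. *)
Definition unroot (e : {set T}) : kgraph k T := KGraph (unroot_subproof e).

Lemma ne_in_unroot (e : {set T}) (B : kgraph k T) : e \in eset F ->
  subgraph B (unroot e) -> ne_in B e = 0%N.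
Proof.
move=> eF /andP[_ /subsetP BE]; apply/eqP; rewrite cards_eq0; apply/eqP/setP => e'.
rewrite in_set0 in_set; apply/negP => /andP[e'B sub].
have := BE _ e'B; rewrite in_setD1 => /andP[+ _]; rewrite eqEcard sub /=.
by rewrite (edge_card e'B) (edge_card eF) leqnn.
Qed.

Lemma ne_unroot (e : {set T}) : e \in eset F -> ne (unroot e) = (ne F).-1.
Proof. by move=> eF; rewrite /ne (cardsD1 e (eset F)) eF. Qed.

Lemma subgraph_refl (A : kgraph k T) : subgraph A A.
Proof. by rewrite /subgraph !subxx. Qed.

(** Adding [e] to a subtemplate turns its density over [e] into a k-density. *)
Lemma unroot_balanced (e : {set T}) : e \in eset F -> strictly_balanced (unroot e) e.
Proof.
move=> eF B eB BA BeE BneA; have f3 := ne_ge3 hF; have km := nv_gt hF.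
have ce := edge_card eF; have /andP[BV BE] := BA.
have kB : (k < nv B)%N.
  by rewrite -[X in (X < _)%N]ce; apply: proper_card; rewrite properEneq eq_sym BeE.
have VA : (vset (unroot e) == e) = false.
  by apply/negbTE; apply: contraTneq km => VE; rewrite -[X in (X < _)%N]ce -VE ltnn.
rewrite /tdensity (negPf BeE) VA !ne_in_unroot ?subgraph_refl // !subr0 ne_unroot // ce.
rewrite -!natrB ?(ltnW km) ?(ltnW kB) // density_lt ?subn_gt0 //.
have [B0|Bpos] := posnP (ne B).
  by rewrite B0 mul0n muln_gt0 subn_gt0 kB andbT; lia.
pose B' := e |: eset B.
have eB' : e \notin eset B by apply/negP => /(subsetP BE); rewrite in_setD1 eqxx.
have cB' : #|B'| = (ne B).+1 by rewrite cardsU1 eB'.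
have B'F : B' \subset eset F.
  rewrite subUset sub1set eF /=; apply: subset_trans BE _; exact: subsetDl.
have cov : cover B' \subset vset B.
  by rewrite coverU subUset cover_edges_sub andbT /cover big_set1.
have [full|nfull] := eqVneq (cover B', B') (vset F, eset F); last first.
  have := spanned_density hF B'F _ nfull; rewrite cB' => /(_ Bpos) h.
  apply: leq_trans h _; rewrite leq_mul // leq_sub2r //; exact: subset_leq_card.
case: full => fV fE; exfalso; move/eqP: BneA; apply; apply: kgraph_eq.
  by apply/eqP; rewrite eqEsubset BV /= /vset /= -fV.
by rewrite /eset /= -fE /B' setU1K.
Qed.

Variables (U : finType) (H : kgraph k U) (R : realType) (c : R).
Hypothesis hB : bounded (4 * nv F) c H.

(** The bound that boundedness gives for the template [unroot e] over [e]. *)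
Definition rooted_max : R :=
  c * Num.max 1 ((nv H)%:R ^+ (nv F - k) * theta R H ^+ (ne F).-1).

Definition rooted (e1 : {set T}) (e : {set U}) :=
  [set phi : {ffun {x | x \in vset F} -> U} |
    [&& injectiveb phi, [forall x, phi x \in vset H],
        [forall e' in eset F, img phi e' \in eset H] & img phi e1 == e]].

Lemma extensions_unroot (e1 : {set T}) (psi : {x | x \in e1} -> U) : e1 \in eset F ->
  injective psi -> (forall x, psi x \in vset H) ->
  #|extensions (unroot e1) H psi|%:R <= rooted_max.
Proof.
move=> e1F inj inH.
have le4 : (nv (unroot e1) <= 4 * nv F)%N by rewrite (_ : nv (unroot e1) = nv F) // leq_pmull.
have tp : template (unroot e1) e1 by exact: (edge_sub e1F).
have := hB tp (unroot_balanced e1F) le4 inj inH.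
rewrite /phihat ne_in_unroot ?subgraph_refl // subn0 ne_unroot // (edge_card e1F).
by [].
Qed.

Hypothesis c0 : 0 <= c.

(** Sort the embeddings that map [e1] onto [e] by their restrictions to [e1]. *)
Lemma card_rooted (e1 : {set T}) (e : {set U}) : e1 \in eset F -> #|e| = k ->
  #|rooted e1 e|%:R <= (k ^ k)%:R * rooted_max.
Proof.
move=> e1F ek; have sub (x : {x | x \in e1}) : val x \in vset F.
  by apply: (subsetP (edge_sub e1F)); apply: valP.
pose restr (phi : {ffun {x | x \in vset F} -> U}) : {ffun {x | x \in e1} -> U} :=
  [ffun x => phi (exist _ (val x) (sub x))].
rewrite -sum1_card (partition_big restr (fun psi => psi \in ffun_on (mem e))) /=; last first.
  move=> phi; rewrite in_set => /and4P[_ _ _ /eqP <-]; apply/ffun_onP => x.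
  by rewrite ffunE imgE imset_f // inE /=; apply: valP.
rewrite natr_sum.
have -> : (k ^ k)%:R * rooted_max = \sum_(psi in ffun_on (mem e) : pred {ffun {x | x \in e1} -> U}) rooted_max.
  rewrite sumr_const card_ffun_on ek card_sig -[rooted_max *+ _]mulr_natl.
  by rewrite (_ : #|[pred x in e1]| = k) //; rewrite -(edge_card e1F).
apply: ler_sum => psi _; rewrite sum1_card.
have M0 : 0 <= rooted_max by rewrite mulr_ge0 // le_max ler01.
have [->|] := eqVneq #|[pred phi in rooted e1 e | restr phi == psi]| 0%N; first by [].
rewrite -lt0n => /card_gt0P[phi0]; rewrite inE => /andP[].
rewrite in_set => /and4P[/injectiveP inj0 /forallP in0 _ _] /eqP r0.
apply: le_trans (extensions_unroot (psi := psi) e1F _ _).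
- rewrite ler_nat; apply/subset_leq_card/subsetP => phi; rewrite inE => /andP[].
  rewrite in_set => /and4P[injp inp /forall_inP Ep _] /eqP rp.
  apply/and4P; split.
  - exact: injp.
  - exact: inp.
  - apply/forallP => x; apply/forallP => y; apply/implyP => /eqP xy.
    rewrite -rp ffunE; apply/eqP; congr (phi _); exact: val_inj.
  - apply/forall_inP => e'; rewrite in_setD1 => /andP[_ e'F]; apply/implyP => _.
    exact: Ep.
- move=> x y; rewrite -r0 !ffunE => /inj0 /(congr1 val) /= xy; exact: val_inj.
- by move=> x; rewrite -r0 ffunE.
Qed.

Lemma degree_bound (e : {set U}) :
  #|[set C in hyperedges F H | e \in C]|%:R <= (ne F * k ^ k)%:R * rooted_max.
Proof.
have M0 : 0 <= rooted_max by rewrite mulr_ge0 // le_max ler01.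
have [ek|ek] := eqVneq #|e| k; last first.
  suff -> : #|[set C in hyperedges F H | e \in C]| = 0%N by rewrite mulr_ge0.
  apply/eqP; rewrite cards_eq0; apply/eqP/setP => C; rewrite in_set0 in_set; apply/negP => /andP[/hyperedge_sub CH eC].
  by rewrite (edge_card (subsetP CH _ eC)) eqxx in ek.
apply: le_trans (_ : (\sum_(e1 in eset F) #|rooted e1 e|)%:R <= _); last first.
  rewrite natr_sum natrM -mulrA.
  apply: le_trans (_ : \sum_(e1 in eset F) (k ^ k)%:R * rooted_max <= _).
    by apply: ler_sum => e1 e1F; apply: card_rooted.
  by rewrite sumr_const -[X in X <= _]mulr_natl.
rewrite ler_nat.
pose edges (phi : {ffun {x | x \in vset F} -> U}) := [set img phi e' | e' in eset F].
apply: leq_trans (_ : (#|\bigcup_(e1 in eset F) (edges @: rooted e1 e)| <= _)%N).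
  apply/subset_leq_card/subsetP => E; rewrite in_set => /andP[/imsetP[C CH ECd]]; rewrite {}ECd => eC.
  have [g [gI gV gE]] := copy_iso CH; move: eC; rewrite -gE => /imsetP[e1 e1F eE].
  apply/bigcupP; exists e1 => //; apply: imset_f; rewrite in_set eE eqxx andbT.
  move: CH; rewrite in_set => /andP[/andP[sV sE] _]; apply/and3P; split.
  - exact/injectiveP.
  - apply/forallP => x; apply: (subsetP sV); rewrite -gV imgE imset_f // inE.
    exact: valP.
  - apply/forall_inP => e' e'F; apply: (subsetP sE); rewrite -gE; exact: imset_f.
apply: leq_trans (card_bigcup_le _ _) _.
by apply: leq_sum => e1 _; apply: leq_imset_card.
Qed.
End RootedCount.

(** * The number of edges in light templates *)

(** The weight is v (a - b e / v) for v vertices and e edges.  So passing to a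
    denser template with fewer vertices keeps it below any positive bound that it
    satisfies: it becomes nonpositive, or both factors decrease. *)
Lemma wt_shrink (a b nA eA nB eB : nat) (w : int) : 0 < w -> (0 < nA)%N ->
  (nB <= nA)%N -> (eA * nB <= eB * nA)%N ->
  (a * nA)%N%:Z - (b * eA)%N%:Z < w -> (a * nB)%N%:Z - (b * eB)%N%:Z < w.
Proof.
move=> w0 nA0 nBA dens wA; rewrite ltNge; apply/negP => wB.
have dens' : eA%:Z * nB%:Z <= eB%:Z * nA%:Z by rewrite -!PoszM lez_nat.
have nBA' : nB%:Z <= nA%:Z by rewrite lez_nat.
have nA0' : 0 < nA%:Z by rewrite ltz_nat.
have nB0 : 0 <= nB%:Z by [].
have b0 : 0 <= b%:Z by [].
rewrite !PoszM in wA wB.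
have h1 := ler_wpM2l b0 dens'.
set x := a%:Z * nA%:Z - b%:Z * eA%:Z in wA; set y := a%:Z * nB%:Z - b%:Z * eB%:Z in wB.
have xy : nA%:Z * y <= nB%:Z * x.
  have -> : nA%:Z * y = a%:Z * nA%:Z * nB%:Z - b%:Z * (eB%:Z * nA%:Z) by rewrite /y; ring.
  have -> : nB%:Z * x = a%:Z * nA%:Z * nB%:Z - b%:Z * (eA%:Z * nB%:Z) by rewrite /x; ring.
  by rewrite lerD2l lerN2.
have h2 : nA%:Z * w <= nA%:Z * y by rewrite ler_pM2l.
have h3 : nB%:Z * x <= nA%:Z * (w - 1).
  have [x0|x0] := lerP 0 x.
    apply: le_trans (_ : nA%:Z * x <= _); first by rewrite ler_wpM2r.
    rewrite ler_pM2l //; move: wA; move: (x) => z; lia.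
  apply: le_trans (_ : 0 <= _).
    by rewrite mulr_ge0_le0 // ltW.
  rewrite mulr_ge0 //; lia.
have := le_trans (le_trans h2 xy) h3; rewrite ler_pM2l //; lia.
Qed.

Lemma empty_sig (T : finType) (x : {x : T | x \in set0}) : False.
Proof. by case: x => x; rewrite in_set0. Qed.

Definition nomap (T U : finType) (x : {x : T | x \in set0}) : U :=
  False_rect U (empty_sig x).

Section BadEdges.
Variables (k : nat) (T : finType) (F : kgraph k T).
Hypothesis hk : (2 <= k)%N.
Hypothesis hF : strictly_kbalanced F.

Notation fwt := (wt (ne F).-1 (nv F - k)).

Lemma w0_gt0 : 0 < w0 F.
Proof.
rewrite /w0 subr_gt0 ltz_nat; apply: leq_trans (nv_lt hk hF) _.
by rewrite leq_mul // leq_pred.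
Qed.

Definition light (V : finType) (A : kgraph k V) : bool :=
  (0 < ne A)%N &&
  (((ne F).-1 * nv A)%N%:Z - ((nv F - k) * ne A)%N%:Z < w0 F).

Lemma ne_in_set0 (V : finType) (A : kgraph k V) : ne_in A set0 = 0%N.
Proof.
apply/eqP; rewrite cards_eq0; apply/eqP/setP => e; rewrite in_set0 in_set.
apply/negP => /andP[eA]; rewrite subset0 => /eqP e0; have := edge_card eA.
by rewrite e0 cards0 => k0; move: hk; rewrite -k0.
Qed.

Lemma nv_ge_edge (V : finType) (A : kgraph k V) : (0 < ne A)%N -> (0 < nv A)%N.
Proof.
rewrite card_gt0 => /set0Pn[e eA]; apply: leq_trans (subset_leq_card (edge_sub eA)).
by rewrite (edge_card eA) ltnW.
Qed.

Lemma subgraph_trans (V : finType) (A B C : kgraph k V) :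
  subgraph A B -> subgraph B C -> subgraph A C.
Proof.
move=> /andP[h1 h2] /andP[h3 h4].
by rewrite /subgraph (subset_trans h1) ?(subset_trans h2).
Qed.

(** A smallest light subtemplate: if a subtemplate were at least as dense, it would
    also be light, by [wt_shrink]. *)
Lemma light_balanced (V : finType) (A0 : kgraph k V) : light A0 ->
  exists A, [/\ subgraph A A0, light A & strictly_balanced A set0].
Proof.
move=> lA0; pose P (B : kgraph k V) := subgraph B A0 && light B.
have PA0 : P A0 by rewrite /P lA0 /subgraph !subxx.
case: (arg_minnP (fun B => nv B + ne B)%N PA0) => A /andP[AA0 lA] minA.
exists A; split=> // B _ BA BV BneA.
have /andP[eA wA] := lA; have vA := nv_ge_edge eA.
have VA : (vset A == set0) = false.
  by apply/negbTE; rewrite -card_gt0.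
have vB : (0 < nv B)%N by rewrite card_gt0.
rewrite /tdensity (negPf BV) VA !ne_in_set0 cards0 !subr0 density_lt // ltnNge.
apply/negP => dens.
have /andP[sV sE] := BA.
have nBA : (nv B <= nv A)%N by apply: subset_leq_card.
have eBA : (ne B <= ne A)%N by apply: subset_leq_card.
have lB : light B.
  apply/andP; split; last exact: wt_shrink w0_gt0 vA nBA dens wA.
  by have : (0 < ne B * nv A)%N; [apply: leq_trans dens; rewrite muln_gt0 eA vB | rewrite muln_gt0 => /andP[]].
have := minA B; rewrite /P (subgraph_trans BA AA0) lB => /(_ isT) szA.
move/eqP: BneA; apply; apply: kgraph_eq; apply/eqP.
  by rewrite eqEcard sV /= -(leq_add2r (ne A)) (leq_trans szA) // leq_add2l.
by rewrite eqEcard sE /= -(leq_add2l (nv A)) (leq_trans szA) // leq_add2r.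
Qed.

Variables (U : finType) (H : kgraph k U).
Variable t : nat.

Definition bad_type (A : kgraph k 'I_t) : Prop := light A /\ strictly_balanced A set0.

(** Templates live on the fixed vertex set ['I_t] so that their number depends on
    [t] and [k] alone; this number enters the constants of the theorem. *)
Definition bad_edges : {set {set U}} :=
  \bigcup_(A : kgraph k 'I_t | `[< bad_type A >])
    \bigcup_(phi in extensions A H (@nomap 'I_t U)) [set img phi e | e in eset A].

(** Transport [Y] to ['I_t], pass to a strictly balanced light subtemplate there,
    and map it back into H. *)
Lemma light_has_bad (Y : {set {set U}}) : Y \subset eset H -> Y != set0 ->
  (#|cover Y| <= t)%N -> fwt Y < w0 F -> ~~ [disjoint Y & bad_edges].
Proof.
move=> YH /set0Pn[e0 e0Y] Vt wY; set V := cover Y in Vt.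
have VH : V \subset vset H by apply: subset_trans (coverS YH) (cover_edges_sub H).
have eV e : e \in Y -> e \subset V by move=> eY; apply: (bigcup_max e).
have ek e : e \in Y -> #|e| = k by move=> eY; apply: (edge_card (subsetP YH _ eY)).
have [x0 x0V] : exists x, x \in V.
  have /card_gt0P[x xe] : (0 < #|e0|)%N by rewrite ek // ltnW.
  by exists x; apply: (subsetP (eV _ e0Y)).
have t0 : (0 < t)%N by apply: leq_trans Vt; apply/card_gt0P; exists x0.
pose h (x : U) : 'I_t := insubd (Ordinal t0) (index x (enum V)).
pose g (i : 'I_t) : U := nth x0 (enum V) i.
have gh : {in V, cancel h g}.
  move=> x xV; rewrite /g /h val_insubd.
  have ix : (index x (enum V) < #|V|)%N by rewrite cardE index_mem mem_enum.
  by rewrite (leq_trans ix Vt) nth_index // mem_enum.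
have ghS (e : {set U}) : e \subset V -> g @: (h @: e) = e.
  move=> /subsetP eV'; rewrite -imset_comp -[RHS]imset_id.
  by apply: eq_in_imset => x /eV' /gh.
have hV : {in V &, injective h} := can_in_inj gh.
have pf : is_kgraph k (h @: V, [set h @: (e : {set U}) | e in Y]).
  apply/forall_inP => _ /imsetP[e eY ->] /=; rewrite imsetS ?eV //=.
  by rewrite card_in_imset ?ek // => x y /(subsetP (eV _ eY)) + /(subsetP (eV _ eY)); apply: hV.
have lA0 : light (KGraph pf).
  have hI : {in Y &, injective (fun e : {set U} => h @: e)}.
    by move=> e e' eY e'Y E; rewrite -(ghS e) ?eV // E ghS ?eV.
  rewrite /light /nv /ne /vset /eset /= (card_in_imset hV) (card_in_imset hI).
  by rewrite card_gt0 wY andbT; apply/set0Pn; exists e0.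
have [A [/andP[sV sE] lA sbA]] := light_balanced lA0.
(* g is a left inverse of h on V, so that phi maps the transported edges back. *)
pose phi : {ffun {x | x \in vset A} -> U} := [ffun s => g (val s)].
have phiE (e : {set U}) : e \in Y -> h @: e \in eset A -> img phi (h @: e) = e.
  move=> eY hA; rewrite imgE -[RHS](ghS e) ?eV //; apply/setP => y.
  apply/imsetP/imsetP => [[s + ->]|[s she ->]].
    by rewrite inE => sh; exists (val s); rewrite // ffunE.
  have sA := subsetP (edge_sub hA) _ she.
  by exists (exist _ s sA); rewrite ?inE // ffunE.
have [e1 e1A] : exists e, e \in eset A by apply/set0Pn; rewrite -card_gt0; case/andP: lA.
have /imsetP[e eY E1] := subsetP sE _ e1A; rewrite E1 in e1A.
rewrite disjoint_subset; apply/subsetPn; exists e => //; rewrite inE /= negbK.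
apply/bigcupP; exists A; first exact/asboolP.
apply/bigcupP; exists phi; last by apply/imsetP; exists (h @: e); rewrite ?phiE.
rewrite in_set; apply/and4P; split.
- apply/injectiveP => s1 s2; rewrite !ffunE => gE; apply: val_inj.
  have /imsetP[x1 x1V E1'] := subsetP sV _ (valP s1).
  have /imsetP[x2 x2V E2'] := subsetP sV _ (valP s2).
  by move: gE; rewrite E1' E2' !gh // => ->.
- apply/forallP => s; have /imsetP[x xV E] := subsetP sV _ (valP s).
  by rewrite ffunE E gh // (subsetP VH).
- by apply/forallP => s; apply/forallP => y; case: (empty_sig y).
- apply/forall_inP => e' e'A; apply/implyP => _.
  have /imsetP[e2 e2Y E2] := subsetP sE _ e'A; rewrite E2 in e'A *.
  by rewrite phiE // (subsetP YH).
Qed.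

Variables (R : realType) (c K : R).
Hypothesis hB : bounded t c H.
Hypothesis c0 : 0 <= c.
Hypothesis K1 : 1 <= K.
Hypothesis hK : forall A : kgraph k 'I_t, light A ->
  (nv H)%:R ^+ nv A * theta R H ^+ ne A <= K.

Lemma card_bad_edges :
  #|bad_edges|%:R <= (#|{: kgraph k 'I_t}| * 2 ^ t)%:R * (c * K).
Proof.
apply: le_trans (_ : \sum_(A : kgraph k 'I_t | `[< bad_type A >]) (2 ^ t)%:R * (c * K) <= _); last first.
  rewrite sumr_const natrM -mulrA -[X in X <= _]mulr_natl ler_wpM2r ?ler_nat ?max_card //.
  by rewrite !mulr_ge0 // (le_trans _ K1).
apply: le_trans (_ : (\sum_(A : kgraph k 'I_t | `[< bad_type A >])
   #|\bigcup_(phi in extensions A H (@nomap 'I_t U)) [set img phi e | e in eset A]|)%:R <= _).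
  by rewrite ler_nat card_bigcup_le.
rewrite natr_sum; apply: ler_sum => A /asboolP[lA sb].
apply: le_trans (_ : (#|extensions A H (@nomap 'I_t U)| * 2 ^ t)%:R <= _).
  rewrite ler_nat; apply: card_bigcup_leM => // phi _.
  apply: leq_trans (leq_imset_card _ _) _; apply: leq_trans (max_card _) _.
  by rewrite -cardsT -powersetT card_powerset cardsT card_ord.
rewrite natrM mulrC ler_wpM2l //.
have tA : template A set0 by apply: sub0set.
have nvt : (nv A <= t)%N by rewrite -[X in (_ <= X)%N]card_ord max_card.
apply: le_trans (hB tA sb nvt _ _) _; try by move=> x; case: (empty_sig x).
rewrite ler_wpM2l // ge_max K1 /phihat cards0 subn0 ne_in_set0 subn0.
exact: hK.
Qed.
End BadEdges.

(** * Failure probability of the removal process *)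

Section RemovalFailure.
Variables (k : nat) (T : finType) (F : kgraph k T).
Hypothesis hk : (2 <= k)%N.
Hypothesis hF : strictly_kbalanced F.
Variables (U : finType) (H : kgraph k U).
Hypothesis hpop : populated F H.

Notation cc := (hyperedges F H).
Notation f := (ne F).
Notation bad := (bad_edges F H (4 * nv F)).

(** The neighbourhood must reach every copy of a 4-cycle through [C]. *)
Definition near_bad : {set {set {set U}}} :=
  [set C in cc | [exists C1 in cc, [exists C2 in cc,
    [&& ~~ [disjoint C & C1], ~~ [disjoint C1 & C2] & ~~ [disjoint C2 & bad]]]]].

Variable Dl : nat.
Hypothesis degH : forall e, (#|[set C in cc | e \in C]| <= Dl)%N.

Lemma deg_hyper (S : {set {set U}}) e : (deg cc S e <= Dl)%N.
Proof.
apply: leq_trans (degH e); apply/subset_leq_card/subsetP => C.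
by rewrite !in_set => /andP[/andP[-> _] ->].
Qed.

Let unif C : C \in cc -> #|C| = f := @hyperedge_card k T F U H C.

Let f3 : (2 < f)%N := ne_ge3 hF.

(** There are at most [Dl] choices for a copy through a bad edge, and [f * Dl] for
    each of the two further steps. *)
Lemma card_near_bad : (#|cc :&: near_bad| <= #|bad| * (Dl * (f * Dl * (f * Dl))))%N.
Proof.
have meet (C D : {set {set U}}) : C \in cc -> ~~ [disjoint C & D] -> C \in meeting cc setT D.
  by move=> CC CD; rewrite in_set in_live CC subsetT.
have sub : cc :&: near_bad \subset \bigcup_(e in bad)
    \bigcup_(C2 in [set C in cc | e \in C])
      \bigcup_(C1 in meeting cc setT C2) meeting cc setT C1.
  apply/subsetP => C; rewrite in_setI => /andP[CC]; rewrite in_set CC /=.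
  move=> /exists_inP[C1 C1C /exists_inP[C2 C2C /and3P[CC1 C1C2]]].
  rewrite disjoint_subset => /subsetPn[e eC2]; rewrite inE /= negbK => eb.
  apply/bigcupP; exists e => //; apply/bigcupP; exists C2; first by rewrite in_set C2C.
  by apply/bigcupP; exists C1; apply: meet.
apply: leq_trans (subset_leq_card sub) _.
apply: card_bigcup_leM => // e _; apply: card_bigcup_leM => [|C2]; first exact: degH.
have inc (C D : {set {set U}}) : C \in meeting cc setT D -> C \in cc.
  by rewrite in_set in_live => /andP[/andP[]].
rewrite in_set => /andP[C2C _].
apply: card_bigcup_leM; first exact: (card_meeting_le unif deg_hyper setT C2C).
by move=> C1 /inc C1C; exact: (card_meeting_le unif deg_hyper setT C1C).
Qed.

Lemma self_meet (C : {set {set U}}) : C \in cc -> ~~ [disjoint C & C].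
Proof.
by move=> CC; rewrite -setI_eq0 setIid -card_gt0 unif // (leq_trans _ f3).
Qed.

Lemma light_near (C C1 C2 : {set {set U}}) :
  C \in cc -> C1 \in cc -> C2 \in cc -> C \notin near_bad ->
  ~~ [disjoint C & C1] -> ~~ [disjoint C1 & C2] -> [disjoint C2 & bad].
Proof.
move=> CC C1C C2C Cn m1 m2; apply/negPn; apply: contra Cn => m3.
rewrite in_set CC /=; apply/exists_inP; exists C1 => //.
by apply/exists_inP; exists C2; rewrite // m1 m2.
Qed.

Lemma cover_union (C D : {set {set U}}) : (#|cover (C :|: D)| <= #|cover C| + #|cover D|)%N.
Proof. by rewrite coverU leq_card_setU. Qed.

Lemma near_lin (C D : {set {set U}}) : C \in cc -> C \notin near_bad -> D \in cc -> D != C ->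
  (#|C :&: D| <= 1)%N.
Proof.
move=> CC Cn DC DneC; rewrite leqNgt; apply/negP => CD.
have lw := overlap_light unif (hyperedge_wt hk hF (H := H)) (hyperedge_wt2 hF (H := H)) CC DC DneC CD.
have sub : C :|: D \subset eset H by rewrite subUset !(hyperedge_sub (F := F)).
have ne0 : C :|: D != set0.
  by rewrite -card_gt0 (leq_trans _ (subset_leq_card (subsetUl C D))) // unif // (leq_trans _ f3).
have cv : (#|cover (C :|: D)| <= 4 * nv F)%N.
  apply: leq_trans (cover_union C D) _.
  by rewrite (hyperedge_cover hF CC) (hyperedge_cover hF DC) addnn -mul2n leq_mul.
have mCD : ~~ [disjoint C & D] by rewrite -setI_eq0 -card_gt0 (leq_trans _ CD).
have := light_has_bad hk hF sub ne0 cv lw.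
rewrite -setI_eq0 setIUl setU_eq0 !setI_eq0.
by rewrite (light_near CC CC CC Cn) ?self_meet // (light_near CC CC DC Cn) ?self_meet.
Qed.

Lemma near_cyc (P A B C : {set {set U}}) : [/\ P \in cc, A \in cc, B \in cc & C \in cc] ->
  P \notin near_bad -> A != B -> [disjoint P & C] ->
  ~~ [disjoint A & P] -> ~~ [disjoint B & P] ->
  ~~ [disjoint A & C] -> ~~ [disjoint B & C] -> False.
Proof.
move=> [PC AC BC CC] Pn AB dPC mAP mBP mAC mBC.
have [Y YZ [Y0 wY]] := cycle_light f3 unif (hyperedge_wt hk hF (H := H))
  (hyperedge_wt2 hF (H := H)) PC AC BC CC AB dPC mAP mBP mAC mBC.
have sub : Y \subset eset H.
  by apply: subset_trans YZ _; rewrite !subUset !(hyperedge_sub (F := F)).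
have cv : (#|cover Y| <= 4 * nv F)%N.
  apply: leq_trans (subset_leq_card (coverS YZ)) _.
  have h1 := cover_union P A; have h2 := cover_union (P :|: A) B.
  have h3 := cover_union (P :|: A :|: B) C.
  apply: leq_trans h3 _; rewrite (hyperedge_cover hF CC).
  rewrite (_ : (4 * nv F = nv F + nv F + nv F + nv F)%N); last by rewrite !mulSn mul0n addn0 !addnA.
  rewrite leq_add2r; apply: leq_trans h2 _; rewrite (hyperedge_cover hF BC) leq_add2r.
  by apply: leq_trans h1 _; rewrite (hyperedge_cover hF PC) (hyperedge_cover hF AC).
have /negP := light_has_bad hk hF sub Y0 cv wY; apply.
apply: disjointWl YZ _; rewrite -setI_eq0 !setIUl !setU_eq0 !setI_eq0.
have mPA : ~~ [disjoint P & A] by rewrite disjoint_sym.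
have mPB : ~~ [disjoint P & B] by rewrite disjoint_sym.
rewrite (light_near PC PC PC Pn) ?self_meet // (light_near PC PC AC Pn) ?self_meet //.
by rewrite (light_near PC PC BC Pn) ?self_meet // (light_near PC AC CC Pn).
Qed.

Lemma populated_deg e : e \in eset H -> (2 <= deg cc (eset H) e)%N.
Proof.
move=> eH; apply: leq_trans (hpop eH) _.
have inj : {in [set G in copies F H | e \in eset G] &, injective (@eset k U)}.
  have sub C : C \in [set G in copies F H | e \in eset G] -> C \in copies F H.
    by rewrite in_set => /andP[].
  by move=> C D /sub CH /sub DH; exact: (eset_inj hF CH DH).
rewrite -(card_in_imset inj); apply/subset_leq_card/subsetP => E /imsetP[G + ->].
rewrite inE => /andP[GH eG]; have GC : eset G \in cc by apply: imset_f.
by rewrite in_set in_live GC eG (hyperedge_sub GC).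
Qed.

Variable R : realType.

Lemma removal_fail (beta M s0 j0 : nat) (Q : pred nat) (E0 : R) :
  (0 < Dl)%N ->
  (#|bad| * (Dl * (f * Dl * (f * Dl))) <= beta)%N ->
  (forall r, (s0 <= r)%N -> Q r) ->
  2 * f%:R <= E0 ->
  32 * f%:R * s0%:R <= E0 ->
  8 * f%:R * j0%:R <= E0 ->
  32 * f%:R ^+ 3 * Dl%:R * beta%:R <= E0 ->
  8192 * f%:R ^+ 4 * M%:R * Dl%:R <= E0 ->
  E0 <= (ne H)%:R ->
  1 - removal_prob R F H Q <=
    2 ^+ s0 * (1 - lone_rate f Dl R) ^+ j0 + (Dl%:R ^+ (64 * f) * E0 / (ne H)%:R) ^+ M.
Proof.
move=> Dl0 hbeta hQ h1 h2 h3 h4 h5 h6.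
rewrite /removal_prob (removal_greedy hF (H := H)) ?/subgraph ?subxx //.
exact: (greedy_fail unif deg_hyper near_lin f3 (leq_trans card_near_bad hbeta) near_cyc
  Dl0 hQ h1 h2 h3 h4 h5 populated_deg h6).
Qed.
End RemovalFailure.

(** * Estimates for powers of n *)

Section Asymptotics.
Variable R : realType.

Lemma eventually_le (C a b : R) : a < b ->
  exists n0 : nat, forall n : nat, (n0 <= n)%N -> C * n%:R `^ a <= n%:R `^ b.
Proof.
move=> ab; have ba : 0 < b - a by rewrite subr_gt0.
pose C' := Num.max C 1; have C'1 : 1 <= C' by rewrite le_max lexx orbT.
have C'0 : 0 <= C' by apply: le_trans C'1.
exists (Num.truncn (C' `^ (b - a)^-1)).+1 => n hn.
have n0 : 0 < n%:R :> R by rewrite ltr0n (leq_trans _ hn).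
have -> : b = (b - a) + a by rewrite subrK.
rewrite powRD; last by rewrite (gt_eqF n0) implybT.
rewrite ler_wpM2r ?powR_ge0 // (@le_trans _ _ C') ?le_max ?lexx //.
have -> : C' = (C' `^ (b - a)^-1) `^ (b - a).
  by rewrite -powRrM mulVf ?gt_eqF // powRr1.
apply: ge0_ler_powR; rewrite ?nnegrE ?powR_ge0 ?(ltW ba) ?(ltW n0) //.
by apply: le_trans (ltW (truncnS_gt _)) _; rewrite ler_nat.
Qed.

Lemma expRN1_ge : 4^-1 <= expR (-1) :> R.
Proof.
have -> : -1 = - 2^-1 + - 2^-1 :> R by field.
have h : 2^-1 <= expR (- 2^-1) :> R by apply: le_trans (expR_ge1Dx _); lra.
rewrite expRD; apply: le_trans (_ : 2^-1 * 2^-1 <= _); first by lra.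
by rewrite ler_pM ?invr_ge0.
Qed.

Lemma expRN1_le : expR (-1) <= 2^-1 :> R.
Proof.
rewrite expRN lef_pV2 ?posrE ?expR_gt0 //.
by have := expR_ge1Dx (1 : R); rewrite -[1 + 1]/(2%:R).
Qed.

(** Both terms are at most half the right side: the first is at most
    e^(s0 - b j0), and 8^-M is at most 4^-M / 2. *)
Lemma tail_bound (b z : R) (s0 j0 M : nat) : b <= 1 -> z < M%:R -> (0 < M)%N ->
  s0%:R + z + 1 <= b * j0%:R ->
  2 ^+ s0 * (1 - b) ^+ j0 + 8^-1 ^+ M <= expR (- z).
Proof.
move=> b1 zM M0 hb.
have half x : x <= expR (-1) * expR (- z) -> x <= 2^-1 * expR (- z).
  by move=> h; apply: le_trans h _; rewrite ler_wpM2r ?expR_ge0 ?expRN1_le.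
have first_term : 2 ^+ s0 * (1 - b) ^+ j0 <= 2^-1 * expR (- z).
  apply: half; rewrite -expRD.
  apply: le_trans (_ : expR 1 ^+ s0 * expR (- b) ^+ j0 <= _).
    apply: ler_pM; rewrite ?exprn_ge0 // ?subr_ge0 //.
      apply: lerXn2r; rewrite ?nnegrE ?expR_ge0 //.
      by have := expR_ge1Dx (1 : R); rewrite -[1 + 1]/(2%:R).
    apply: lerXn2r; rewrite ?nnegrE ?expR_ge0 ?subr_ge0 //.
    exact: expR_ge1Dx.
  rewrite -!expRM_natl -expRD ler_expR mulr1 mulrN [j0%:R * b]mulrC.
  by move: hb; move: (b * j0%:R) => w; lra.
have second_term : 8^-1 ^+ M <= 2^-1 * expR (- z).
  have -> : 8^-1 = 2^-1 * 4^-1 :> R by rewrite -invfM -natrM.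
  rewrite exprMn; apply: ler_pM; rewrite ?exprn_ge0 ?invr_ge0 //.
    case: M M0 {zM} => // M _; rewrite exprS ler_piMr ?invr_ge0 // exprn_ile1 ?invr_ge0 //.
    by rewrite invf_le1 ?ler1n.
  apply: le_trans (_ : expR (-1) ^+ M <= _).
    by apply: lerXn2r; rewrite ?nnegrE ?expR_ge0 ?invr_ge0 ?expRN1_ge.
  by rewrite -expRM_natl ler_expR mulrN1 lerN2 ltW.
have -> : expR (- z) = 2^-1 * expR (- z) + 2^-1 * expR (- z) by field.
exact: lerD.
Qed.

(** For a light template with [v] vertices and [w] edges, weights are integers,
    so being below [w0] costs at least 1 in the weight and 1 / a in the exponent
    of the expected number of copies. *)
Lemma light_exponent (a b c v w : R) : 0 < a -> a * v + b + 1 <= a * c + b * w ->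
  v - w * (b / a) <= c - b / a - a^-1.
Proof.
move=> a0 h; rewrite -(ler_pM2l a0).
have -> : a * (v - w * (b / a)) = a * v - b * w by field; rewrite gt_eqF.
have -> : a * (c - b / a - a^-1) = a * c - b - 1 by field; rewrite gt_eqF.
lra.
Qed.

Lemma exponent_room_linear (eps u t d ft fd sd ai g : R) :
  0 < eps -> eps <= 600^-1 -> u <= eps / 600 -> 0 < t -> t <= u / 600 ->
  0 < d -> d <= t / 600 -> ft <= u / 200 -> fd <= t / 200 -> sd <= t / 600 ->
  200 * eps <= ai -> 1 < g ->
  [/\ fd < t, 0 < g - d - 64 * ft, g - eps + 2 * t < g - d - 64 * ft,
    g - ai + (sd + d) + 4 * t < g - d - 64 * ft
    & 4^-1 + t < g - d - 64 * ft /\ 4^-1 <= g - eps].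
Proof. by move=> *; split; [lra|lra|lra|lra|split; lra]. Qed.

(** The exponents, up to constants, of the requirements on the parameters.  With
    eps f and eps s small, eps^3 f and eps^4 s are negligible compared with eps
    and with 1 / a. *)
Lemma exponent_room (f s eps a g : R) (d := eps ^+ 4) (t := eps ^+ 3)
    (e := g - d - 64 * f * t) :
  3 <= f -> 1 <= s -> 0 < eps -> eps * (200 * f * s) < 1 -> a = f - 1 -> 1 < g ->
  [/\ f * d < t, 0 < e, g - eps + 2 * t < e, g - a^-1 + (s + 1) * d + 4 * t < e
    & 4^-1 + t < e /\ 4^-1 <= g - eps].
Proof.
move=> f3 s1 e0 hfs aE g1.
have fs : 3 <= f * s by rewrite -[3]mulr1 ler_pM //; lra.
have ef : eps * f <= 200^-1.
  have : eps * f * 1 <= eps * f * s by rewrite ler_wpM2l // mulr_ge0 //; lra.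
  by rewrite (_ : eps * (200 * f * s) = 200 * (eps * f * s)) in hfs; [lra | ring].
have es : eps * s <= 600^-1.
  have : eps * s * 3 <= eps * s * f by rewrite ler_wpM2l // mulr_ge0 //; lra.
  by rewrite (_ : eps * (200 * f * s) = 200 * (eps * s * f)) in hfs; [lra | ring].
have e600 : eps <= 600^-1.
  have : eps * 1 <= eps * s by rewrite ler_wpM2l // ltW.
  lra.
pose u := eps ^+ 2; have u0 : 0 < u by rewrite exprn_gt0.
have hu : u <= eps / 600 by rewrite /u expr2 ler_wpM2l // ltW.
have t0 : 0 < t by rewrite exprn_gt0.
have d0 : 0 < d by rewrite exprn_gt0.
have tE : t = u * eps by rewrite /t /u; ring.
have dE : d = t * eps by rewrite /d /t; ring.
have ht : t <= u / 600 by rewrite tE ler_wpM2l // ltW.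
have hd : d <= t / 600 by rewrite dE ler_wpM2l // ltW.
have hft : f * t <= u / 200.
  by rewrite (_ : f * t = u * (eps * f)) ?ler_wpM2l ?(ltW u0) // tE; ring.
have hfd : f * d <= t / 200.
  by rewrite (_ : f * d = t * (eps * f)) ?ler_wpM2l ?(ltW t0) // dE; ring.
have hsd : s * d <= t / 600.
  by rewrite (_ : s * d = t * (eps * s)) ?ler_wpM2l ?(ltW t0) // dE; ring.
have ha : 200 * eps <= a^-1.
  rewrite -[X in _ <= X]mul1r ler_pdivlMr; last by lra.
  by rewrite aE mulrBr mulr1 -mulrA; lra.
rewrite /e -[64 * f * t]mulrA [(s + 1) * d]mulrDl mul1r.
exact: (exponent_room_linear e0 e600 hu t0 ht d0 hd hft hfd hsd ha g1).
Qed.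
End Asymptotics.

(** * Choice of the parameters *)

Section ParameterChoice.
Variables (R : realType) (n f Dl badn N : nat) (eps g a s C : R).
Notation y x := (n%:R `^ x : R).
Let d := eps ^+ 4.
Let t := eps ^+ 3.
Let e := g - d - 64 * f%:R * t.
Hypothesis n1 : (0 < n)%N.
Hypothesis f3 : (2 < f)%N.
Hypothesis Dl0 : (0 < Dl)%N.
Hypothesis Dlt : Dl%:R <= y t.
Hypothesis Nge : y (g - d) <= N%:R.
Hypothesis C0 : 0 <= C.
Hypothesis badn_le : badn%:R <= C * y (g - a^-1 + (s + 1) * d).
Hypothesis room0 : 128 * f%:R * y 0 <= y e.
Hypothesis room1 : 2048 * f%:R ^+ 3 * y (g - eps + 2 * t) <= y e.
Hypothesis room2 : 256 * f%:R ^+ 5 * C * y (g - a^-1 + (s + 1) * d + 4 * t) <= y e.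
Hypothesis room3 : 16 * (8192 * f%:R ^+ 4) * y (4^-1 + t) <= y e.
Hypothesis quarter : 4^-1 <= g - eps.

(** Chosen to make the base of the second term in [removal_fail] equal to 1/8. *)
Definition edge_floor : R := N%:R / (8 * Dl%:R ^+ (64 * f)).
Definition survivor_goal : nat := (Num.truncn (y (g - eps))).+1.
Definition lone_goal : nat := Num.truncn (edge_floor / (8 * f%:R)).
Definition epochs : nat := (Num.truncn (y 4^-1)).+1.

Let F0 : 0 < f%:R :> R. Proof. by rewrite ltr0n (leq_trans _ f3). Qed.
Let F1 : 1 <= f%:R :> R. Proof. by rewrite ler1n (leq_trans _ f3). Qed.
Let D1 : 1 <= Dl%:R :> R. Proof. by rewrite ler1n. Qed.
Let D0 : 0 < Dl%:R :> R. Proof. by rewrite ltr0n. Qed.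

Let yD u v : y u * y v = y (u + v).
Proof. by rewrite powRD // pnatr_eq0 -lt0n n1 implybT. Qed.

Let yX u (j : nat) : y u ^+ j = y (j%:R * u).
Proof. by rewrite mulrC powRrM powR_mulrn ?powR_ge0. Qed.

Let y_ge1 u : 0 <= u -> 1 <= y u.
Proof.
have n1R : 1 <= n%:R :> R by rewrite ler1n.
by move/(ler_powR n1R); rewrite powRr0.
Qed.

Let DlX j : Dl%:R ^+ j <= y (j%:R * t).
Proof. by rewrite -yX; apply: lerXn2r; rewrite ?nnegrE ?powR_ge0. Qed.

Lemma edge_floor_ge : y e <= 8 * edge_floor.
Proof.
have DX : 0 < Dl%:R ^+ (64 * f) :> R by rewrite exprn_gt0.
have -> : 8 * edge_floor = N%:R / Dl%:R ^+ (64 * f).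
  by rewrite /edge_floor invfM mulrCA mulVKf ?pnatr_eq0.
rewrite ler_pdivlMr //; apply: le_trans Nge.
have -> : g - d = e + (64 * f)%:R * t by rewrite natrM /e subrK.
by rewrite -(yD e) ler_wpM2l ?powR_ge0.
Qed.

Lemma edge_floor_le : edge_floor <= N%:R.
Proof.
rewrite /edge_floor ler_piMr // invf_le1 ?mulr_gt0 ?exprn_gt0 //.
by rewrite mulr_ege1 ?exprn_ege1 // ler1n.
Qed.

Lemma edge_floor_ge16 : 16 * f%:R <= edge_floor.
Proof.
rewrite -(ler_pM2l (_ : 0 < 8)) //; apply: le_trans edge_floor_ge.
have -> : 8 * (16 * f%:R) = 128 * f%:R * y 0 by rewrite powRr0; ring.
exact: room0.
Qed.

Let Y1 : 1 <= y (g - eps).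
Proof. by apply: y_ge1; apply: le_trans quarter; rewrite invr_ge0. Qed.

Lemma survivor_goal_le : survivor_goal%:R <= 2 * y (g - eps).
Proof.
rewrite /survivor_goal -natr1 mulrDl mul1r lerD // truncn_le; exact: powR_ge0.
Qed.

(** The number of survivors aimed at is smaller than E0 by a power of n, which
    exceeds the powers of [Dl] that are lost in the argument. *)
Lemma survivor_room : 256 * f%:R ^+ 3 * y (g - eps) * Dl%:R ^+ 2 <= edge_floor.
Proof.
rewrite -(ler_pM2l (_ : 0 < 8)) //; apply: le_trans edge_floor_ge.
apply: le_trans room1; rewrite -(yD (g - eps) (2 * t)).
have -> : 8 * (256 * f%:R ^+ 3 * y (g - eps) * Dl%:R ^+ 2) =
  2048 * f%:R ^+ 3 * y (g - eps) * Dl%:R ^+ 2 by ring.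
rewrite mulrA; apply: ler_wpM2l (DlX 2).
by rewrite ?mulr_ge0 ?exprn_ge0 ?powR_ge0.
Qed.

Lemma epochs_le : epochs%:R <= 2 * y 4^-1.
Proof.
rewrite /epochs -natr1 mulrDl mul1r lerD // ?truncn_le ?powR_ge0 //.
by apply: y_ge1; rewrite invr_ge0.
Qed.

Lemma survivor_fit : 32 * f%:R * survivor_goal%:R <= edge_floor.
Proof.
apply: le_trans survivor_room.
apply: le_trans (_ : 32 * f%:R * (2 * y (g - eps)) <= _).
  by rewrite ler_wpM2l ?survivor_goal_le // mulr_ge0.
have -> : 32 * f%:R * (2 * y (g - eps)) = 64 * f%:R * y (g - eps) * 1 by ring.
have -> : 256 * f%:R ^+ 3 * y (g - eps) * Dl%:R ^+ 2 =
  64 * f%:R * y (g - eps) * (4 * f%:R ^+ 2 * Dl%:R ^+ 2) by ring.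
rewrite ler_wpM2l ?mulr_ge0 ?powR_ge0 //.
by rewrite !mulr_ege1 ?exprn_ege1 // ler1n.
Qed.

Lemma lone_fit : 8 * f%:R * lone_goal%:R <= edge_floor.
Proof.
have p : 0 < 8 * f%:R :> R by rewrite mulr_gt0.
rewrite mulrC -ler_pdivlMr // truncn_le divr_ge0 ?(ltW p) //.
by apply: le_trans edge_floor_ge16; rewrite mulr_ge0.
Qed.

Lemma bad_fit :
  32 * f%:R ^+ 3 * Dl%:R * (badn * (Dl * (f * Dl * (f * Dl))))%:R <= edge_floor.
Proof.
rewrite -(ler_pM2l (_ : 0 < 8)) //; apply: le_trans edge_floor_ge.
apply: le_trans room2; rewrite -(yD (g - a^-1 + (s + 1) * d) (4 * t)).
rewrite !natrM.
have -> : 8 * (32 * f%:R ^+ 3 * Dl%:R *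
   (badn%:R * (Dl%:R * (f%:R * Dl%:R * (f%:R * Dl%:R))))) =
   256 * f%:R ^+ 5 * (badn%:R * Dl%:R ^+ 4) :> R by ring.
have h : badn%:R * Dl%:R ^+ 4 <= C * y (g - a^-1 + (s + 1) * d) * y (4 * t).
  by apply: ler_pM (DlX 4); rewrite ?exprn_ge0.
set K := 256 * f%:R ^+ 5; have K0 : 0 <= K by rewrite mulr_ge0 ?exprn_ge0.
by rewrite -[K * C * _]mulrA [C * (_ * _)]mulrA ler_wpM2l.
Qed.

Lemma epochs_fit : 8192 * f%:R ^+ 4 * epochs%:R * Dl%:R <= edge_floor.
Proof.
rewrite -(ler_pM2l (_ : 0 < 8)) //; apply: le_trans edge_floor_ge.
apply: le_trans room3; rewrite -(yD 4^-1 t).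
set K : R := 8192 * f%:R ^+ 4; have K0 : 0 <= K by rewrite mulr_ge0 ?exprn_ge0.
have -> : 8 * (K * epochs%:R * Dl%:R) = 8 * K * (epochs%:R * Dl%:R) by ring.
have -> : 16 * K * (y 4^-1 * y t) = 8 * K * (2 * y 4^-1 * y t) by ring.
rewrite ler_wpM2l ?mulr_ge0 //.
by rewrite ler_pM ?epochs_le.
Qed.

Lemma lone_beats_survivors :
  survivor_goal%:R + y 4^-1 + 1 <= lone_rate f Dl R * lone_goal%:R.
Proof.
have z_le : y 4^-1 <= y (g - eps) by apply: ler_powR; rewrite // ler1n.
apply: le_trans (_ : 4 * y (g - eps) <= _).
  have -> : 4 * y (g - eps) = 2 * y (g - eps) + y (g - eps) + y (g - eps) by ring.
  by rewrite !lerD ?survivor_goal_le.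
have p : 0 < 16 * f%:R :> R by rewrite mulr_gt0.
(* Rounding down costs at most a factor 2, as the rounded number is at least 2. *)
have j_ge : edge_floor / (16 * f%:R) <= lone_goal%:R.
  have h1 : 1 <= edge_floor / (16 * f%:R) by rewrite ler_pdivlMr // mul1r edge_floor_ge16.
  have h2 : edge_floor / (8 * f%:R) < lone_goal%:R + 1.
    by rewrite natr1 truncnS_gt.
  have h3 : edge_floor / (8 * f%:R) = edge_floor / (16 * f%:R) + edge_floor / (16 * f%:R).
    by field; rewrite gt_eqF.
  rewrite h3 in h2; move: h1 h2; move: (edge_floor / _) (lone_goal%:R) => u v; lra.
apply: le_trans (_ : lone_rate f Dl R * (edge_floor / (16 * f%:R)) <= _); last first.
  by rewrite ler_wpM2l // ltW // lone_rate_gt0.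
have -> : lone_rate f Dl R * (edge_floor / (16 * f%:R)) =
    edge_floor / (64 * f%:R ^+ 3 * Dl%:R ^+ 2).
  by rewrite /lone_rate natrM; field; rewrite !gt_eqF.
rewrite ler_pdivlMr ?mulr_gt0 ?exprn_gt0 //; apply: le_trans survivor_room.
by rewrite le_eqVlt; apply/orP; left; apply/eqP; ring.
Qed.

End ParameterChoice.

(** * Expected numbers of copies of templates, and the theorem *)

Section TemplateSize.
Variables (R : realType) (k : nat) (T : finType) (F : kgraph k T).
Hypothesis hk : (2 <= k)%N.
Hypothesis hF : strictly_kbalanced F.
Variables (U : finType) (H : kgraph k U) (n : nat) (d : R).
Hypothesis nH : nv H = n.
Hypothesis n1 : (0 < n)%N.
Notation y x := (n%:R `^ x : R).

(** 1 / rho, so that H has about n^(k - sparsity) edges. *)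
Definition sparsity : R := (nv F - k)%:R / (ne F).-1%:R.

Hypothesis H_le : (ne H)%:R <= y (k%:R - sparsity + d).

Let a0 : 0 < (ne F).-1%:R :> R.
Proof. by have := ne_ge3 hF; rewrite ltr0n; case: (ne F) => [|[]]. Qed.

Lemma kdensity_inv : (ratr (kdensity F) : R)^-1 = sparsity.
Proof.
have f3 := ne_ge3 hF; have km := nv_gt hF.
rewrite kdensityE ?(ltnW km) //; last by rewrite (leq_trans _ f3).
by rewrite fmorph_div /= !ratr_nat invf_div.
Qed.

Lemma edge_exponent_gt1 : 1 < k%:R - sparsity.
Proof.
rewrite ltrBrDl -ltrBrDr /sparsity ltr_pdivrMr //.
have -> : k%:R - 1 = k.-1%:R :> R by case: k hk => // k' _; rewrite -natr1 addrK.
by rewrite -natrM ltr_nat mulnC nv_lt.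
Qed.

Let yD u v : y u * y v = y (u + v).
Proof. by rewrite powRD // pnatr_eq0 -lt0n n1 implybT. Qed.

Let yX u (j : nat) : y u ^+ j = y (j%:R * u).
Proof. by rewrite mulrC powRrM powR_mulrn ?powR_ge0. Qed.

Let yn (j : nat) : n%:R ^+ j = y j%:R.
Proof. by rewrite powR_mulrn. Qed.

Lemma theta_ge0 : 0 <= theta R H.
Proof. by rewrite divr_ge0 ?mulr_ge0 ?exprn_ge0. Qed.

Lemma theta_le : theta R H <= k`!%:R * y (d - sparsity).
Proof.
rewrite /theta nH ler_pdivrMr ?exprn_gt0 ?ltr0n // yn -mulrA yD mulrC ler_wpM2l //.
by apply: le_trans H_le _; rewrite (_ : k%:R - sparsity + d = d - sparsity + k%:R) //; ring.
Qed.

(** The expected number of copies of a template with [v] new vertices and [e] new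
    edges, when the density is at most n^(d - sparsity). *)
Lemma template_le (v e : nat) :
  (nv H)%:R ^+ v * theta R H ^+ e
    <= k`!%:R ^+ e * y (v%:R - e%:R * sparsity + e%:R * d).
Proof.
have -> : v%:R - e%:R * sparsity + e%:R * d = v%:R + e%:R * (d - sparsity) by ring.
rewrite -yD -yX -yn nH mulrCA -exprMn ler_wpM2l ?exprn_ge0 //.
by apply: lerXn2r; rewrite ?nnegrE ?theta_ge0 ?theta_le // mulr_ge0 ?powR_ge0.
Qed.

Let fact1 : 1 <= k`!%:R :> R.
Proof. by rewrite ler1n fact_gt0. Qed.

Let n1R : 1 <= n%:R :> R.
Proof. by rewrite ler1n. Qed.

Let y_ge1 u : 0 <= u -> 1 <= y u.
Proof. by move/(ler_powR n1R); rewrite powRr0. Qed.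

Hypothesis d0 : 0 <= d.

(** A copy of F over one of its edges has m - k new vertices and f - 1 new edges,
    and the definition of rho makes the expected number n^0 up to the error
    [d]. *)
Lemma rooted_max_le :
  rooted_max F H (y d) <= k`!%:R ^+ (ne F).-1 * y ((ne F)%:R * d).
Proof.
have -> : (ne F)%:R * d = d + (ne F).-1%:R * d.
  by rewrite -[X in _ = X + _]mul1r -mulrDl nat1r prednK // (leq_trans _ (ne_ge3 hF)).
rewrite /rooted_max -yD mulrCA ler_wpM2l ?powR_ge0 // ge_max; apply/andP; split.
  by rewrite mulr_ege1 ?exprn_ege1 ?y_ge1 // mulr_ge0.
apply: le_trans (template_le _ _) _.
have -> : (nv F - k)%:R - (ne F).-1%:R * sparsity = 0.
  by rewrite /sparsity mulrCA divff ?mulr1 ?subrr // gt_eqF.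
by rewrite add0r.
Qed.

(** A light template has fewer expected copies than H has edges, by a power of n. *)
Lemma light_le (t : nat) (A : kgraph k 'I_t) : light F A ->
  (nv H)%:R ^+ nv A * theta R H ^+ ne A
    <= k`!%:R ^+ (2 ^ t) *
       y (k%:R - sparsity - (ne F).-1%:R^-1 + (2 ^ t)%:R * d).
Proof.
move=> /andP[_ wA]; apply: le_trans (template_le _ _) _.
have eA : (ne A <= 2 ^ t)%N.
  by apply: leq_trans (max_card _) _; rewrite -cardsT -powersetT card_powerset cardsT card_ord.
apply: ler_pM; rewrite ?exprn_ge0 ?powR_ge0 //; first exact: ler_weXn2l.
apply: ler_powR => //; apply: lerD; last by rewrite ler_wpM2r // ler_nat.
set a := (ne F).-1 in wA *; set b := (nv F - k)%N in wA *.
have wN : (a * nv A + b + 1 <= a * k + b * ne A)%N.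
  by move: wA; rewrite /w0 -/a -/b; lia.
apply: light_exponent; first exact: a0.
by move: wN; rewrite -(ler_nat R) !natrD !natrM.
Qed.
End TemplateSize.

Theorem theorem1p5 (R : realType) (k : nat) (hk : (2 <= k)%N)
    (T : finType) (F : kgraph k T) (hF : strictly_kbalanced F)
    (m : nat) (hm : nv F = m) (rho : R) (hrho : rho = ratr (kdensity F)) :
  exists eps0 : R, 0 < eps0 < 1 /\
    forall eps : R, 0 < eps < eps0 ->
      exists n0 : nat, forall n : nat, (n0 <= n)%N ->
        forall (U : finType) (H : kgraph k U),
          nv H = n ->
          bounded (4 * m) (n%:R `^ (eps ^+ 4)) H ->
          populated F H ->
          n%:R `^ (k%:R - rho^-1 - eps ^+ 4) <= (ne H)%:R
            <= n%:R `^ (k%:R - rho^-1 + eps ^+ 4) ->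
          1 - expR (- (n%:R `^ (4%:R^-1)))
            <= removal_prob R F H
                 (fun r : nat => n%:R `^ (k%:R - rho^-1 - eps) <= r%:R).
Proof.
have f3 := ne_ge3 hF.
have rhoE : rho^-1 = sparsity R F by rewrite hrho kdensity_inv.
have g1 := edge_exponent_gt1 R hk hF.
rewrite -hm rhoE; set g := k%:R - sparsity R F in g1 *.
set f := ne F in f3 *; set s := (2 ^ (4 * nv F))%N; set a : R := f.-1%:R.
have fR3 : 3 <= f%:R :> R by rewrite ler_nat.
have sR1 : 1 <= s%:R :> R by rewrite ler1n expn_gt0.
have aE : a = f%:R - 1 by rewrite /a -subn1 natrB // (leq_trans _ f3).
have P0 : 0 < 200 * f%:R * s%:R :> R.
  by rewrite !mulr_gt0 ?(lt_le_trans _ fR3) ?(lt_le_trans _ sR1).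
(* s bounds the number of edges of the templates on 'I_(4 m). *)
exists (200 * f%:R * s%:R)^-1; split.
  rewrite invr_gt0 P0 invf_lt1 //=.
  apply: lt_le_trans (_ : 200 * 1 * 1 <= _); first by rewrite !mulr1 ltr1n.
  by rewrite ler_pM ?mulr_ge0 // ler_wpM2l // (le_trans _ fR3) ?ler1n.
move=> eps /andP[eps0 epsP].
have epsP' : eps * (200 * f%:R * s%:R) < 1 by rewrite -ltr_pdivlMr // mul1r.
(* Each strict inequality between exponents absorbs the constant in front. *)
have [r1 r2 r3 r4 [r5 r6]] := exponent_room fR3 sR1 eps0 epsP' aE g1.
pose Cd : R := (f * k ^ k)%:R * k`!%:R ^+ f.-1.
pose C : R := (#|{: kgraph k 'I_(4 * nv F)}| * s)%:R * k`!%:R ^+ s.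
have [na hna] := eventually_le Cd r1.
have [nb hnb] := eventually_le (128 * f%:R) r2.
have [nc hnc] := eventually_le (2048 * f%:R ^+ 3) r3.
have [nd hnd] := eventually_le (256 * f%:R ^+ 5 * C) r4.
have [ne' hne] := eventually_le (16 * (8192 * f%:R ^+ 4)) r5.
exists (maxn 1 (maxn na (maxn nb (maxn nc (maxn nd ne'))))) => n.
rewrite !geq_max => /andP[n1 /andP[/hna{}hna /andP[/hnb{}hnb /andP[/hnc{}hnc /andP[/hnd{}hnd /hne{}hne]]]]].
move=> U H nH hB hpop /andP[Hge Hle].
have n1R : 1 <= n%:R :> R by rewrite ler1n.
have d0 : 0 <= eps ^+ 4 by rewrite exprn_ge0 // ltW.
have c0 : 0 <= n%:R `^ (eps ^+ 4) :> R by apply: powR_ge0.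
pose Dl := Num.truncn (n%:R `^ (eps ^+ 3) : R).
have t0 : 0 <= n%:R `^ (eps ^+ 3) :> R by apply: powR_ge0.
have Dl0 : (0 < Dl)%N.
  rewrite /Dl truncn_gt0 -[X in X <= _](powRr0 (n%:R : R)); apply: ler_powR => //.
  by rewrite exprn_ge0 // ltW.
have Dlt : Dl%:R <= n%:R `^ (eps ^+ 3) :> R by rewrite truncn_le.
have degH e : (#|[set C in hyperedges F H | e \in C]| <= Dl)%N.
  rewrite /Dl truncn_ge_nat //; have hd := degree_bound hk hF hB c0 e.
  apply: le_trans hd _.
  apply: le_trans hna; rewrite /Cd -mulrA ler_wpM2l //.
  exact: (rooted_max_le hF nH n1 Hle d0).
pose badn := #|bad_edges F H (4 * nv F)|.
have badn_le : badn%:R <= C * n%:R `^ (g - a^-1 + (s%:R + 1) * eps ^+ 4) :> R.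
  have K1 : 1 <= k`!%:R ^+ s * n%:R `^ (g - a^-1 + s%:R * eps ^+ 4) :> R.
    rewrite mulr_ege1 ?exprn_ege1 ?ler1n ?fact_gt0 //.
    rewrite -[X in X <= _](powRr0 (n%:R : R)); apply: ler_powR => //.
    apply: addr_ge0; last by rewrite mulr_ge0.
    rewrite subr_ge0 (le_trans _ (ltW g1)) // invf_le1 /a.
      by rewrite ler1n; case: (f) f3 => [|[]].
    by rewrite ltr0n; case: (f) f3 => [|[]].
  have lightK (A : kgraph k 'I_(4 * nv F)) : light F A ->
      (nv H)%:R ^+ nv A * theta R H ^+ ne A
        <= k`!%:R ^+ s * n%:R `^ (g - a^-1 + s%:R * eps ^+ 4) :> R.
    exact: (light_le hk hF nH n1 Hle d0).
  have hb := card_bad_edges hk hB c0 K1 lightK.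
  apply: le_trans hb _.
  rewrite /C -mulrA ler_wpM2l // mulrCA ler_wpM2l ?exprn_ge0 //.
  rewrite -powRD; last by rewrite pnatr_eq0 -lt0n n1 implybT.
  by rewrite mulrDl mul1r addrCA [eps ^+ 4 + _]addrC.
have C0 : 0 <= C by rewrite mulr_ge0 ?exprn_ge0.
have N0 : 0 < (ne H)%:R :> R by apply: lt_le_trans Hge; rewrite powR_gt0 // ltr0n.
have hQ r : (survivor_goal n eps g <= r)%N -> n%:R `^ (g - eps) <= r%:R.
  move=> h; apply: le_trans (ltW (truncnS_gt _)) _; by rewrite ler_nat.
have floor16 := edge_floor_ge16 n1 Dl0 Dlt Hge hnb.
have fail := removal_fail hk hF hpop degH Dl0 (leqnn _) hQ _
  (survivor_fit n1 f3 Dl0 Dlt Hge hnc r6) (lone_fit n1 f3 Dl0 Dlt Hge hnb)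
  (bad_fit n1 Dl0 Dlt Hge badn_le hnd) (epochs_fit n1 Dl0 Dlt Hge hne)
  (edge_floor_le R f (ne H) Dl0).
have tail := tail_bound (ltW (lone_rate_lt1 f3 R Dl0)) (truncnS_gt _) (ltn0Sn _)
  (lone_beats_survivors n1 f3 Dl0 Dlt Hge hnb hnc r6).
rewrite lerBlDr -lerBlDl; apply: le_trans tail; apply: le_trans (fail _) _.
  by apply: le_trans floor16; rewrite ler_wpM2r // ler_nat.
have DX : Dl%:R ^+ (64 * f) != 0 :> R by rewrite expf_neq0 // pnatr_eq0 -lt0n.
rewrite lerD2l /edge_floor [8 * _]mulrC invfM mulrCA.
by rewrite mulVKf // mulrAC divff ?mul1r // gt_eqF.
Qed.
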